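(* Let $P$ be a monic polynomial of degree $\ge1$ such that $\Omega:=\{z\in\mathbb C:|P(z)|<1\}$ is a Jordan domain which is also a quadrature domain. Then $\Omega$ is a disk.
   Context: A Jordan domain $\Omega$ with boundary $\Gamma$ is called a quadrature domain if there is a function $S$ meromorphic in $\Omega$ with finitely many poles, extending continuously to $\Gamma$, such that $S(z)=\bar z$ for $z\in\Gamma$ ($S$ is the Schwarz function of $\Gamma$); the order of $\Omega$ is the number of poles of $S$ in $\Omega$, counted with multiplicity. *)

(* Defs.v *)
(* The complex plane is [C R] = R[i] (mathcomp-real-closed
   [complex]) over an arbitrary [R : realType], with the norm topology of the
   complex modulus coming from its numFieldType structure. *)
From HB Require Import structures.
From mathcomp Require Import all_boot all_order all_algebra.
From mathcomp Require Import all_classical all_reals all_analysis.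
From mathcomp Require Export complex.
Import Order.TTheory GRing.Theory Num.Theory.
Import numFieldNormedType.Exports.

Set Implicit Arguments.
Unset Strict Implicit.
Unset Printing Implicit Defensive.

Local Open Scope ring_scope.
Local Open Scope classical_set_scope.

(* The complex plane, as a numClosedFieldType (hence normed over itself). *)
Definition C (R : realType) : numClosedFieldType := R[i].

(* A Jordan curve: the image of a continuous 1-periodic map R -> C which is
   injective on [0,1) (i.e. a homeomorphic image of the circle). *)
Definition jordan_curve (R : realType) (Gamma : set (C R)) : Prop :=
  exists gamma : R -> C R,
    continuous gamma /\
    (forall t : R, gamma (t + 1) = gamma t) /\
    {in `[0, 1[%classic &, injective gamma} /\
    range gamma = Gamma.

(* Omega is a Jordan domain with boundary Gamma: a bounded domain (open, connected)
   whose boundary (closure minus itself, Omega being open) is the Jordan curve Gamma. *)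
Definition jordan_domain (R : realType) (Omega Gamma : set (C R)) : Prop :=
  [/\ open Omega, connected Omega, Omega !=set0, bounded_set Omega
      & jordan_curve Gamma /\ closure Omega `\` Omega = Gamma].

(* Quadrature domain (as in the paper): Omega is a Jordan domain with boundary
   Gamma, and there is a function S, meromorphic in Omega with finitely many poles
   (the finite set Z contained in Omega: S is complex differentiable on Omega \ Z
   and |S z| -> +oo at each point of Z), extending continuously to Gamma
   (S is continuous on closure Omega \ Z = (Omega \ Z) u Gamma), with
   S z = conj z on Gamma. *)
Definition quadrature_domain (R : realType) (Omega : set (C R)) : Prop :=
  exists Gamma : set (C R),
    jordan_domain Omega Gamma /\
    exists (S : C R -> C R) (Z : set (C R)),
      [/\ finite_set Z /\ Z `<=` Omega,
          (forall z, Omega z -> ~ Z z -> derivable S z 1),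
          (forall p, Z p -> forall M : R, \forall x \near p^', (M%:C)%C < `|S x|),
          {within closure Omega `\` Z, continuous S} &
          (forall z, Gamma z -> S z = z^*)].

(* Main.v *)
Require Import Defs.
From HB Require Import structures.
From mathcomp Require Import all_boot all_order all_algebra.
From mathcomp Require Import all_classical all_reals all_analysis.
From mathcomp Require Import complex.
From mathcomp Require Import ring lra.
Import Order.TTheory GRing.Theory Num.Theory.
Import numFieldNormedType.Exports.
Local Open Scope ring_scope.
Local Open Scope classical_set_scope.
Set Implicit Arguments.
Unset Strict Implicit.
Unset Printing Implicit Defensive.

(** Let [P^#] be [P] with conjugated coefficients. On the boundary curve [|P| = 1] and
    [S z = z^*], so [P z * P^#(S z) = 1] there; as [S] has only finitely many poles, the
    maximum principle, applied after multiplication by a polynomial vanishing at the poles,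
    propagates this identity to all of [Omega]. Hence the poles of [S] are the roots of [P],
    and at a root [p] of multiplicity [m] one has [|S z|^n ~ c |z - p|^-m] with [n = deg P].
    If [m < n], then [(z - p) S z --> 0], so the singularity of [S] at [p] is removable,
    contradicting [|S| --> oo]. Therefore [m = n] and [P = (X - p)^n].

    The complex analysis rests on Goursat's lemma for rectangles, which gives a crude
    Cauchy estimate on squares; powers of functions turn it into the maximum principle,
    and the maximum principle for differences of slope functions gives the removable
    singularity theorem, by which zeros are divided out one order at a time to see that
    poles have finite order. *)

(** * The complex modulus and holomorphy *)

(** Two obstacles shape the development. At a point of [Z] one only knows that |S| tends to
    infinity, so finiteness of the pole order has to be derived before a polynomial factor can clear
    the poles. And complex contour integrals are avoided: [loop] combines values of real primitives,
    one for each variable, and every estimate along an edge is a mean value argument. The price is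
    an estimate that loses a constant factor, [1 / 4] on the square against [1] at the centre.
    Passing to [N]-th powers amplifies any strict inequality to that size; the same device makes the
    polynomial factor that kills exceptional points harmless as [N] grows. At a root of multiplicity
    [m < n] no [n]-th root is extracted either: m + 1 <= n gives |(z - p) S z|^n <= C |z - p|
    directly. *)

Lemma derivable_eps (K : numClosedFieldType) (f : K -> K) (z : K) :
  derivable f z 1 -> exists d : K, forall e : K, 0 < e ->
  \forall w \near z, `|f w - f z - d * (w - z)| <= e * `|w - z|.
Proof.
move=> /cvg_ex[d /= H]; exists d => e e0.
move/cvgrPdist_le: H => /(_ e e0).
move=> /= /nbhs_ballP[r /= r0 H].
apply/nbhs_ballP; exists r => //= w; rewrite -ball_normE /= => zw.
have [->|wz] := eqVneq w z; first by rewrite !subrr mulr0 subr0 normr0 mulr0.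
have h0 : w - z != 0 by rewrite subr_eq0.
have := H (w - z); rewrite -ball_normE /= sub0r opprB => /(_ zw h0).
rewrite [(w - z)%:A]mulr1 subrK => H1.
rewrite -ler_pdivrMr ?normr_gt0// -normf_div mulrBl mulfK// distrC.
by rewrite [_ / _]mulrC.
Qed.

(* Locked because conversion between instances of [derivable] at [C R] diverges. *)
HB.lock Definition holo (R : realType) (f : C R -> C R) (z : C R) : Prop :=
  derivable f z 1.

Section ComplexModulus.
Variable R : realType.
Implicit Types z w : C R.

Definition cre z : R := complex.Re z.
Definition cim z : R := complex.Im z.
Definition mkC (x y : R) : C R := Complex x y.
(** The norm of [C R] takes values in [C R], whose order is only partial. This real-valued copy
    admits case analysis on the order, and [lra]. *)
Definition cmod z : R := complex.Re `|z|.

Lemma normC_cmod z : `|z| = (cmod z)%:C%C.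
Proof. by []. Qed.

Lemma mkC_re_im z : mkC (cre z) (cim z) = z.
Proof. by case: z. Qed.

Lemma cre_mk x y : cre (mkC x y) = x. Proof. by []. Qed.
Lemma cim_mk x y : cim (mkC x y) = y. Proof. by []. Qed.

Lemma creD z w : cre (z + w) = cre z + cre w.
Proof. by case: z w => ? ? [? ?]. Qed.
Lemma cimD z w : cim (z + w) = cim z + cim w.
Proof. by case: z w => ? ? [? ?]. Qed.
Lemma creN z : cre (- z) = - cre z.
Proof. by case: z => ? ?. Qed.
Lemma cimN z : cim (- z) = - cim z.
Proof. by case: z => ? ?. Qed.
Lemma creM z w : cre (z * w) = cre z * cre w - cim z * cim w.
Proof. by case: z w => ? ? [? ?]. Qed.
Lemma cimM z w : cim (z * w) = cre z * cim w + cim z * cre w.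
Proof. by case: z w => ? ? [? ?]. Qed.
Lemma cre_conj z : cre z^* = cre z.
Proof. by case: z. Qed.
Lemma cim_conj z : cim z^* = - cim z.
Proof. by case: z. Qed.
Lemma cre1 : cre 1 = 1. Proof. by []. Qed.
Lemma cim1 : cim 1 = 0. Proof. by []. Qed.

Lemma cmod_sqr z : cmod z ^+ 2 = cre z ^+ 2 + cim z ^+ 2.
Proof. by have := add_Re2_Im2 z; rewrite normC_cmod -rmorphXn => /complexI. Qed.

Lemma cmod_ge0 z : 0 <= cmod z.
Proof. by have := normr_ge0 z; rewrite normC_cmod ler0c. Qed.

Lemma cmodD z w : cmod (z + w) <= cmod z + cmod w.
Proof. by have := ler_normD z w; rewrite !normC_cmod -rmorphD lecR. Qed.

Lemma cmodM z w : cmod (z * w) = cmod z * cmod w.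
Proof. by have := normrM z w; rewrite !normC_cmod -rmorphM => /complexI. Qed.

Lemma cmodN z : cmod (- z) = cmod z.
Proof. by have := normrN z; rewrite !normC_cmod => /complexI. Qed.

Lemma cmod0 : cmod 0 = 0.
Proof. by have := normr0 (C R); rewrite normC_cmod => /complexI. Qed.

Lemma cmod1 : cmod 1 = 1.
Proof. by have := normr1 (C R); rewrite normC_cmod => /complexI. Qed.

Lemma cmod_eq0 z : (cmod z == 0) = (z == 0).
Proof. by rewrite -(normr_eq0 z) normC_cmod -(inj_eq (@complexI R)). Qed.

Lemma cmod_real (x : R) : 0 <= x -> cmod (mkC x 0) = x.
Proof.
move=> x0; apply/eqP; rewrite -(@eqrXn2 _ 2)// ?cmod_ge0//.
by rewrite cmod_sqr cre_mk cim_mk expr0n addr0.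
Qed.

Section HoloCalculus.
Variables (f g : C R -> C R) (z : C R).
Lemma holoD : holo f z -> holo g z -> holo (fun w => f w + g w) z.
Proof. rewrite holo.unlock; exact: derivableD. Qed.
Lemma holoB : holo f z -> holo g z -> holo (fun w => f w - g w) z.
Proof. rewrite holo.unlock; exact: derivableB. Qed.
Lemma holoM : holo f z -> holo g z -> holo (fun w => f w * g w) z.
Proof. rewrite holo.unlock; exact: derivableM. Qed.
Lemma holoV : f z != 0 -> holo f z -> holo (fun w => (f w)^-1) z.
Proof. rewrite holo.unlock; exact: derivableV. Qed.
Lemma holo_cst (c : C R) : holo (fun=> c) z.
Proof. rewrite holo.unlock; exact: derivable_cst. Qed.
Lemma holo_id : holo (fun w => w) z.
Proof. rewrite holo.unlock; exact: derivable_id. Qed.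
Lemma holo_near : (\forall w \near z, f w = g w) -> holo f z -> holo g z.
Proof. rewrite holo.unlock; exact: near_eq_derivable. Qed.
Lemma holo_continuous : holo f z -> {for z, continuous f}.
Proof. by rewrite holo.unlock => /derivable1_diffP/differentiable_continuous. Qed.
End HoloCalculus.

Lemma nbhs_cmodP (z : C R) (A : set (C R)) :
  nbhs z A <-> exists2 r : R, 0 < r & forall w, cmod (w - z) < r -> A w.
Proof.
split.
  move/nbhs_ballP => [e /= e0 h].
  have er : e = (complex.Re e)%:C%C by rewrite RRe_real // ger0_real // ltW.
  exists (complex.Re e); first by move: e0; rewrite er ltcR.
  by move=> w hw; apply: h; rewrite -ball_normE /= distrC er normC_cmod ltcR.
move=> [r r0 h]; apply/nbhs_ballP; exists (r%:C)%C; first by rewrite /= ltcR.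
by move=> w; rewrite -ball_normE /= distrC normC_cmod ltcR; exact: h.
Qed.

Lemma holo_cmod (f : C R -> C R) z : holo f z ->
  exists d : C R, forall e : R, 0 < e -> exists2 r : R, 0 < r &
    forall w, cmod (w - z) < r -> cmod (f w - f z - d * (w - z)) <= e * cmod (w - z).
Proof.
rewrite holo.unlock => /derivable_eps[d H]; exists d => e e0.
have /H/nbhs_cmodP[r r0 Hr] : 0 < (e%:C)%C :> C R by rewrite ltcR.
exists r => // w /Hr; rewrite !normC_cmod.
by rewrite -[X in _ <= X]rmorphM lecR.
Qed.

Lemma continuousC_eps (f : C R -> C R) z : {for z, continuous f} <->
  forall e : R, 0 < e -> exists2 r : R, 0 < r & forall w, cmod (w - z) < r ->
    cmod (f w - f z) < e.
Proof.
split.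
  move=> cf e e0; apply/nbhs_cmodP.
  by have /cf : nbhs (f z) [set w : C R | cmod (w - f z) < e] by apply/nbhs_cmodP; exists e.
move=> H A /nbhs_cmodP[e e0 He]; have /H[r r0 Hr] := e0.
apply/nbhs_cmodP; exists r => // w /Hr; exact: He.
Qed.

Lemma cmodB z w : cmod (z - w) = cmod (w - z).
Proof. by rewrite -cmodN opprB. Qed.

Lemma cmodV z : cmod z^-1 = (cmod z)^-1.
Proof.
have [->|z0] := eqVneq z 0; first by rewrite invr0 cmod0 invr0.
apply: (mulfI (x := cmod z)); first by rewrite cmod_eq0.
by rewrite -cmodM !divff ?cmod_eq0 ?cmod1.
Qed.

Lemma cmodX z n : cmod (z ^+ n) = cmod z ^+ n.
Proof. by elim: n => [|n IH]; rewrite ?cmod1// !exprS cmodM IH. Qed.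

Lemma holoX (f : C R -> C R) z n : holo f z -> holo (fun w => f w ^+ n) z.
Proof.
move=> df; elim: n => [|n IH]; first exact: holo_cst.
by under eq_fun do rewrite exprS; exact: holoM.
Qed.

Lemma holo_horner (p : {poly C R}) f z : holo f z -> holo (fun w => p.[f w]) z.
Proof.
move=> df; elim/poly_ind: p => [|p c IH].
  by under eq_fun do rewrite horner0; exact: holo_cst.
under eq_fun do rewrite hornerMXaddC.
by apply: holoD; [exact: holoM|exact: holo_cst].
Qed.

Lemma holo_subid (a : C R) z : holo (fun w => w - a) z.
Proof. by apply: holoB; [exact: holo_id|exact: holo_cst]. Qed.

Lemma cmod_le_sum z : cmod z <= `|cre z| + `|cim z|.
Proof.
rewrite -(@ler_pXn2r _ 2)// ?nnegrE ?cmod_ge0 ?addr_ge0//.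
rewrite cmod_sqr sqrrD !real_normK ?num_real//.
by rewrite -addrA lerD2l lerDr mulrn_wge0// mulr_ge0.
Qed.

Lemma cre_le_cmod z : `|cre z| <= cmod z.
Proof.
by rewrite -(@ler_pXn2r _ 2)// ?nnegrE ?cmod_ge0// cmod_sqr real_normK ?num_real// lerDl
  sqr_ge0.
Qed.

Lemma cim_le_cmod z : `|cim z| <= cmod z.
Proof.
by rewrite -(@ler_pXn2r _ 2)// ?nnegrE ?cmod_ge0// cmod_sqr real_normK ?num_real// lerDr
  sqr_ge0.
Qed.

Lemma cmodB_ge z w : cmod z - cmod w <= cmod (z - w).
Proof. by rewrite lerBlDr -{1}(subrK w z) cmodD. Qed.

Lemma cmod_mkB x y x' y' : cmod (mkC x y - mkC x' y' : C R) <= `|x - x'| + `|y - y'|.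
Proof. by rewrite (le_trans (cmod_le_sum _))// creD cimD creN cimN !cre_mk !cim_mk. Qed.

End ComplexModulus.

(** * Goursat's lemma *)

Section Primitive.
Variable R : realType.

Lemma continuous_primitive (f : R -> R) (c : R) : continuous f ->
  exists F : R -> R, forall x, c < x -> is_derive x 1 F (f x).
Proof.
move=> cf; exists (fun x => (\int[lebesgue_measure]_(t in `[c, x]) f t)%R) => x cx.
(* Ending the interval at [x + 1] makes [x] an interior point, where the fundamental theorem
   applies. *)
have int : lebesgue_measure.-integrable `[c, x + 1] (EFin \o f).
  apply: continuous_compact_integrable; first exact: segment_compact.
  exact: continuous_subspaceT.
have [|//||dF eF] := @continuous_FTC1 R f (BLeft c) x (x + 1) _ int.
- by rewrite ltrDl.
- exact: cf.
by apply: (DeriveDef dF); rewrite -derive1E.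
Qed.

(** The mean value theorem stands in for bounding an integral along an edge, the increment of a
    primitive being that integral. *)
Lemma increment_near_linear (F f : R -> R) (a b c e : R) : a <= b ->
  (forall x, a <= x <= b -> is_derive x 1 F (f x)) ->
  (forall x, a <= x <= b -> `|f x - c| <= e) ->
  `|F b - F a - c * (b - a)| <= e * (b - a).
Proof.
move=> ab dF fc.
have [x||x xab ->] := @MVT_segment _ F f a b ab.
- move=> xab; apply: dF; move: xab; rewrite in_itv /= => /andP[? ?].
  by rewrite !ltW.
- apply: derivable_within_continuous => x; rewrite in_itv /= => /dF dx.
  exact: ex_derive.
- by rewrite -mulrBl normrM (ger0_norm (x := b - a)) ?subr_ge0// ler_wpM2r ?subr_ge0// fc.
Qed.
End Primitive.

Section Goursat.
Variable R : realType.
Implicit Types (A B p q : R -> R -> R).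

(* The integral of [p dx + q dy] around the rectangle with lower left corner [(x, y)],
   width [w] and height [h], where [A] is a primitive of [p] in the first variable and [B]
   one of [q] in the second. *)
Definition loop A B x y w h : R :=
  (A (x + w) y - A x y) + (B (x + w) (y + h) - B (x + w) y)
  - (A (x + w) (y + h) - A x (y + h)) - (B x (y + h) - B x y).

(* [p] and [q] are differentiable at [(x, y)], and the shared coefficient [b] says that
   the partial derivatives [dp/dy] and [dq/dx] agree. *)
Definition closed_form_at p q (x y : R) := exists a b c : R,
  forall e, 0 < e -> exists2 r, 0 < r &
    forall x' y', `|x' - x| < r -> `|y' - y| < r ->
    `|p x' y' - p x y - a * (x' - x) - b * (y' - y)| <= e * (`|x' - x| + `|y' - y|) /\
    `|q x' y' - q x y - b * (x' - x) - c * (y' - y)| <= e * (`|x' - x| + `|y' - y|).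

(** Each inner edge is traversed twice, in opposite directions. *)
Lemma loop_quarters A B x y w h :
  loop A B x y (w + w) (h + h) = loop A B x y w h + loop A B (x + w) y w h
    + loop A B x (y + h) w h + loop A B (x + w) (y + h) w h.
Proof. by rewrite /loop !addrA; ring. Qed.

Definition in_rect (x y w h u v : R) := (x <= u <= x + w) /\ (y <= v <= y + h).

(** The affine part has zero loop: the two horizontal sides together give [- b * h * w], the two
    vertical ones [b * w * h], because [b] is shared. What remains is an error [e * (w + h)] on each
    of the four sides. *)
Lemma loop_small p q A B x y w h u v e : 0 <= w -> 0 <= h ->
  (forall s t, in_rect x y w h s t ->
     is_derive s 1 (A^~ t) (p s t) /\ is_derive t 1 (B s) (q s t)) ->
  in_rect x y w h u v ->
  (exists a b c, forall s t, in_rect x y w h s t ->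
    `|p s t - p u v - a * (s - u) - b * (t - v)| <= e * (`|s - u| + `|t - v|) /\
    `|q s t - q u v - b * (s - u) - c * (t - v)| <= e * (`|s - u| + `|t - v|)) ->
  0 <= e ->
  `|loop A B x y w h| <= 2 * e * (w + h) ^+ 2.
Proof.
move=> w0 h0 dAB uv [a [b [c abc]]] e0.
have bnd s t : in_rect x y w h s t ->
    `|p s t - p u v - a * (s - u) - b * (t - v)| <= e * (w + h) /\
    `|q s t - q u v - b * (s - u) - c * (t - v)| <= e * (w + h).
  move=> st; have [h1 h2] := abc _ _ st.
  have st_le : e * (`|s - u| + `|t - v|) <= e * (w + h).
    move: st uv => [/andP[? ?] /andP[? ?]] [/andP[? ?] /andP[? ?]].
    rewrite ler_wpM2l//; apply: lerD; rewrite ler_norml; lra.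
  by split; [apply: le_trans h1 _|apply: le_trans h2 _].
have rb s : x <= s <= x + w -> in_rect x y w h s y by split=> //; lra.
have rt s : x <= s <= x + w -> in_rect x y w h s (y + h) by split=> //; lra.
have rl t : y <= t <= y + h -> in_rect x y w h x t by split=> //; lra.
have rr t : y <= t <= y + h -> in_rect x y w h (x + w) t by split=> //; lra.
have H1 := @increment_near_linear R (fun s => A s y - A s (y + h))
  (fun s => p s y - p s (y + h)) x (x + w) (- b * h) (2 * (e * (w + h))).
have H2 := @increment_near_linear R (fun t => B (x + w) t - B x t)
  (fun t => q (x + w) t - q x t) y (y + h) (b * w) (2 * (e * (w + h))).
have {}H1 : `|A (x + w) y - A (x + w) (y + h) - (A x y - A x (y + h)) - (- b * h) * w|
     <= 2 * (e * (w + h)) * w.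
  have -> : w = (x + w) - x by ring.
  rewrite {1 2}(_ : x + (x + w - x) = x + w); last by ring.
  rewrite (_ : e * (x + w - x + h) = e * (w + h)); last by ring.
  apply: H1; first by lra.
    move=> s xs; have [d1 _] := dAB _ _ (rb _ xs); have [d2 _] := dAB _ _ (rt _ xs).
    exact: is_deriveB.
  move=> s xs; have [/ler_normlP[? ?] _] := bnd _ _ (rb _ xs).
  have [/ler_normlP[? ?] _] := bnd _ _ (rt _ xs).
  by apply/ler_normlP; split; lra.
have {}H2 : `|B (x + w) (y + h) - B x (y + h) - (B (x + w) y - B x y) - (b * w) * h|
     <= 2 * (e * (w + h)) * h.
  have -> : h = (y + h) - y by ring.
  rewrite {1 2}(_ : y + (y + h - y) = y + h); last by ring.
  rewrite (_ : e * (w + (y + h - y)) = e * (w + h)); last by ring.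
  apply: H2; first by lra.
    move=> s xs; have [_ d1] := dAB _ _ (rr _ xs); have [_ d2] := dAB _ _ (rl _ xs).
    exact: is_deriveB.
  move=> s xs; have [_ /ler_normlP[? ?]] := bnd _ _ (rr _ xs).
  have [_ /ler_normlP[? ?]] := bnd _ _ (rl _ xs).
  by apply/ler_normlP; split; lra.
have -> : 2 * e * (w + h) ^+ 2 = 2 * (e * (w + h)) * w + 2 * (e * (w + h)) * h by ring.
move: H1 H2 => /ler_normlP[? ?] /ler_normlP[? ?].
by apply/ler_normlP; rewrite /loop; split; lra.
Qed.


Lemma in_rectS x y w h x' y' w' h' s t : x <= x' -> y <= y' ->
  x' + w' <= x + w -> y' + h' <= y + h ->
  in_rect x' y' w' h' s t -> in_rect x y w h s t.
Proof. by move=> ? ? ? ? [/andP[? ?] /andP[? ?]]; split; apply/andP; split; lra. Qed.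

(** Bisection: if the loop exceeds [e] times the square of width plus height, so does the loop of
    some quarter, relative to its own size. The nested rectangles shrink to a point at which
    [loop_small] contradicts this. *)
Lemma goursat p q A B x0 y0 w0 h0 : 0 <= w0 -> 0 <= h0 ->
  (forall s t, in_rect x0 y0 w0 h0 s t ->
     is_derive s 1 (A^~ t) (p s t) /\ is_derive t 1 (B s) (q s t)) ->
  (forall s t, in_rect x0 y0 w0 h0 s t -> closed_form_at p q s t) ->
  loop A B x0 y0 w0 h0 = 0.
Proof.
move=> w0_ge0 h0_ge0 dAB cpq.
suff small e : 0 < e -> `|loop A B x0 y0 w0 h0| <= e * (w0 + h0) ^+ 2.
  apply/eqP; rewrite -normr_le0; apply/ler_addgt0Pr => e e0; rewrite add0r.
  have s0 : 0 < (w0 + h0) ^+ 2 + 1 by have := sqr_ge0 (w0 + h0); lra.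
  apply: le_trans (small (e / ((w0 + h0) ^+ 2 + 1)) _) _; first exact: divr_gt0.
  rewrite mulrAC ler_pdivrMr// ler_wpM2l ?ltW//; lra.
move=> e0; apply: contrapT => /negP; rewrite -ltNge => big.
pose W n : R := w0 / 2 ^+ n; pose H n : R := h0 / 2 ^+ n.
have WS n : W n = W n.+1 + W n.+1.
  by rewrite /W exprS invfM mulrA; field; rewrite expf_eq0 pnatr_eq0 andbF.
have HS n : H n = H n.+1 + H n.+1.
  by rewrite /H exprS invfM mulrA; field; rewrite expf_eq0 pnatr_eq0 andbF.
have W0 n : 0 <= W n by rewrite divr_ge0// exprn_ge0.
have H0 n : 0 <= H n by rewrite divr_ge0// exprn_ge0.
pose bad n (z : R * R) := e * (W n + H n) ^+ 2 < `|loop A B z.1 z.2 (W n) (H n)|.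
pose sub n (z z' : R * R) := [/\ z.1 <= z'.1, z.2 <= z'.2,
  z'.1 + W n.+1 <= z.1 + W n & z'.2 + H n.+1 <= z.2 + H n].
(* The implication stands inside the existential, so that choice gives a total function [nxt]. *)
have step n z : exists z', bad n z -> bad n.+1 z' /\ sub n z z'.
  case: (pselect (exists z', bad n.+1 z' /\ sub n z z')) => [[z' Hz']|no].
    by exists z'.
  exists z => bd; exfalso; move: bd; rewrite /bad => bd.
  have good z' : sub n z z' -> `|loop A B z'.1 z'.2 (W n.+1) (H n.+1)| <=
      e * (W n.+1 + H n.+1) ^+ 2.
    by move=> zz'; rewrite leNgt; apply/negP => b; apply: no; exists z'.
  have W1 := W0 n.+1; have H1 := H0 n.+1.
  have bound z' : z'.1 = z.1 \/ z'.1 = z.1 + W n.+1 -> z'.2 = z.2 \/ z'.2 = z.2 + H n.+1 ->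
      `|loop A B z'.1 z'.2 (W n.+1) (H n.+1)| <= e * (W n.+1 + H n.+1) ^+ 2.
    by move=> h1 h2; apply: good; rewrite /sub (WS n) (HS n); case: h1 h2 => -> [] ->;
      split; lra.
  have g1 := bound (z.1, z.2) (or_introl erefl) (or_introl erefl).
  have g2 := bound (z.1 + W n.+1, z.2) (or_intror erefl) (or_introl erefl).
  have g3 := bound (z.1, z.2 + H n.+1) (or_introl erefl) (or_intror erefl).
  have g4 := bound (z.1 + W n.+1, z.2 + H n.+1) (or_intror erefl) (or_intror erefl).
  move: g1 g2 g3 g4 bd; rewrite (WS n) (HS n) loop_quarters /= => g1 g2 g3 g4.
  have -> : e * (W n.+1 + W n.+1 + (H n.+1 + H n.+1)) ^+ 2 =
    4 * (e * (W n.+1 + H n.+1) ^+ 2) by ring.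
  rewrite ltNge => /negP; apply.
  do 3 (apply: le_trans (ler_normD _ _) _; rewrite -?lerBrDr).
  lra.
have /choice[nxt Hnxt] : forall nz : nat * (R * R), exists z', bad nz.1 nz.2 ->
    bad nz.1.+1 z' /\ sub nz.1 nz.2 z' by move=> [n z]; exact: step.
pose Z := fix Z n := if n is m.+1 then nxt (m, Z m) else (x0, y0).
have Zbad n : bad n (Z n).
  elim: n => [|n IH]; last by have [] := Hnxt (n, Z n) IH.
  by rewrite /bad /W /H expr0 !divr1.
have Zsub n : sub n (Z n) (Z n.+1) by have [] := Hnxt (n, Z n) (Zbad n).
have mono n k : [/\ (Z n).1 <= (Z (n + k)%N).1, (Z n).2 <= (Z (n + k)%N).2,
    (Z (n + k)%N).1 + W (n + k)%N <= (Z n).1 + W n &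
    (Z (n + k)%N).2 + H (n + k)%N <= (Z n).2 + H n].
  elim: k => [|k [? ? ? ?]]; first by rewrite addn0 !lexx.
  by rewrite addnS; have [? ? ? ?] := Zsub (n + k)%N; split; lra.
(* Every left edge lies to the left of every right edge, hence the supremum of the left edges
   belongs to all rectangles; likewise for the lower edges. *)
have le1 n m : (Z n).1 <= (Z m).1 + W m.
  have [? _ _ _] := mono n m; have [_ _ + _] := mono m n.
  by rewrite addnC; have := W0 (n + m)%N; lra.
have le2 n m : (Z n).2 <= (Z m).2 + H m.
  have [_ ? _ _] := mono n m; have [_ _ _ +] := mono m n.
  by rewrite addnC; have := H0 (n + m)%N; lra.
pose u := sup (range (fun n => (Z n).1)); pose v := sup (range (fun n => (Z n).2)).
have uv n : in_rect (Z n).1 (Z n).2 (W n) (H n) u v.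
  split; apply/andP; split.
  - apply: ub_le_sup; last by exists n.
    by exists ((Z 0%N).1 + W 0%N) => _ [m _ <-].
  - apply: ge_sup; first by exists (Z 0%N).1, 0%N.
    by move=> _ [m _ <-].
  - apply: ub_le_sup; last by exists n.
    by exists ((Z 0%N).2 + H 0%N) => _ [m _ <-].
  - apply: ge_sup; first by exists (Z 0%N).2, 0%N.
    by move=> _ [m _ <-].
have sub0 n s t : in_rect (Z n).1 (Z n).2 (W n) (H n) s t -> in_rect x0 y0 w0 h0 s t.
  have [? ? + +] := mono 0%N n; rewrite add0n /= /W /H expr0 !divr1 => ? ?.
  exact: in_rectS.
have [a [b [c abc]]] := cpq _ _ (sub0 _ _ _ (uv 0%N)).
(* The factor [2] of [loop_small] brings [e / 2] back to the threshold of [bad]. *)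
have [|r r0 Hr] := abc (e / 2); first by lra.
have [n Hn] : exists n, W n + H n < r.
  exists (Num.bound ((w0 + h0) / r)); have := upper_nthrootP (leqnn (Num.bound ((w0 + h0)
    / r))).
  rewrite /W /H -mulrDl ltr_pdivrMr// => lt.
  by rewrite ltr_pdivrMr ?exprn_gt0// mulrC.
have := Zbad n; rewrite /bad ltNge => /negP; apply.
have -> : e = 2 * (e / 2) by field.
apply: (loop_small (p := p) (q := q) (u := u) (v := v)) => //.
- by move=> s t /sub0; exact: dAB.
- exists a, b, c => s t st; apply: Hr; move: st (uv n) =>
  [/andP[? ?] /andP[? ?]] [/andP[? ?] /andP[? ?]];
  have := W0 n; have := H0 n; rewrite ltr_norml; lra.
- by lra.
Qed.

End Goursat.

(** * Goursat's lemma on a square with an exceptional centre *)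

Section Square.
Variable R : realType.
Implicit Types (A B p q : R -> R -> R).

Lemma loopE A B x1 x2 y1 y2 : loop A B x1 y1 (x2 - x1) (y2 - y1) =
  (A x2 y1 - A x1 y1) + (B x2 y2 - B x2 y1) - (A x2 y2 - A x1 y2) - (B x1 y2 - B x1 y1).
Proof. by rewrite /loop !(addrC x1) !(addrC y1) !subrK. Qed.

(** A small concentric square of half-side [t] cuts the square into nine rectangles. The eight outer
    ones avoid the origin and have zero loop; the loop of the inner one is at most [8 * (M * t)], as
    its perimeter is [8 * t]. *)
Lemma goursat_punctured p q A B (a M : R) : 0 < a ->
  (forall s t : R, `|s| <= a -> `|t| <= a ->
     is_derive s 1 (A^~ t) (p s t) /\ is_derive t 1 (B s) (q s t)) ->
  (forall s t : R, `|s| <= a -> `|t| <= a -> (s != 0) || (t != 0) -> closed_form_at p q s t) ->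
  (exists2 r : R, 0 < r & forall s t : R, `|s| < r -> `|t| < r ->
    `|p s t| <= M /\ `|q s t| <= M) ->
  (A a (- a) - A (- a) (- a)) + (B a a - B a (- a))
    - (A a a - A (- a) a) - (B (- a) a - B (- a) (- a)) = 0.
Proof.
move=> a0 dAB cpq [r r0 pqM].
have Z (x1 x2 y1 y2 : R) : - a <= x1 <= x2 -> x2 <= a -> - a <= y1 <= y2 -> y2 <= a ->
    (0 < x1 \/ x2 < 0) \/ (0 < y1 \/ y2 < 0) ->
    (A x2 y1 - A x1 y1) + (B x2 y2 - B x2 y1) - (A x2 y2 - A x1 y2) - (B x1 y2 - B x1 y1) = 0.
  move=> /andP[? ?] ? /andP[? ?] ? off; rewrite -loopE.
  apply: (goursat (p := p) (q := q)); rewrite ?subr_ge0//.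
    move=> s t [/andP[? ?] /andP[? ?]]; apply: dAB; rewrite ler_norml; lra.
  move=> s t [/andP[? ?] /andP[? ?]]; apply: cpq; rewrite ?ler_norml; lra.
have M0 : 0 <= M.
  have [|| h _] := pqM 0 0; rewrite ?normr0//; exact: le_trans h.
apply/eqP; rewrite -normr_le0; apply/ler_addgt0Pr => e e0; rewrite add0r.
pose t := Num.min (Num.min (r / 2) (a / 2)) (e / (8 * (M + 1))).
have t0 : 0 < t by rewrite !lt_min !divr_gt0//; lra.
have tr : t < r.
  by apply: le_lt_trans (_ : r / 2 < r); [rewrite !ge_min lexx|lra].
have ta : t < a.
  by apply: le_lt_trans (_ : a / 2 < a); [rewrite !ge_min lexx orbT|lra].
have te : 8 * (M * t) <= e.
  have : t <= e / (8 * (M + 1)) by rewrite !ge_min lexx orbT.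
  by rewrite ler_pdivlMr; nra.
have eA y : - t <= y <= t -> `|A t y - A (- t) y| <= M * (2 * t).
  move=> yt; have -> : A t y - A (- t) y = A t y - A (- t) y - 0 * (t - - t) by ring.
  have -> : 2 * t = t - - t by ring.
  apply: (increment_near_linear (F := A^~ y) (f := p^~ y)); first by lra.
    by move=> x xt; apply: (proj1 (dAB x y _ _)); rewrite ler_norml; lra.
  by move=> x xt; rewrite subr0; apply: (proj1 (pqM x y _ _)); rewrite ltr_norml; lra.
have eB x : - t <= x <= t -> `|B x t - B x (- t)| <= M * (2 * t).
  move=> xt; have -> : B x t - B x (- t) = B x t - B x (- t) - 0 * (t - - t) by ring.
  have -> : 2 * t = t - - t by ring.
  apply: (increment_near_linear (F := B x) (f := q x)); first by lra.
    by move=> y yt; apply: (proj2 (dAB x y _ _)); rewrite ler_norml; lra.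
  by move=> y yt; rewrite subr0; apply: (proj2 (pqM x y _ _)); rewrite ltr_norml; lra.
have l1 : - a <= - a <= - t by lra.
have l2 : - a <= - t <= t by lra.
have l3 : - a <= t <= a by lra.
have u1 : - t <= a by lra.
have nt : - t < 0 by lra.
have t1 : - t <= t <= t by lra.
have t2 : - t <= - t <= t by lra.
have := Z _ _ _ _ l1 u1 l1 u1 (or_introl (or_intror nt)).
have := Z _ _ _ _ l2 (ltW ta) l1 u1 (or_intror (or_intror nt)).
have := Z _ _ _ _ l3 (lexx a) l1 u1 (or_introl (or_introl t0)).
have := Z _ _ _ _ l1 u1 l2 (ltW ta) (or_introl (or_intror nt)).
have := Z _ _ _ _ l3 (lexx a) l2 (ltW ta) (or_introl (or_introl t0)).
have := Z _ _ _ _ l1 u1 l3 (lexx a) (or_introl (or_intror nt)).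
have := Z _ _ _ _ l2 (ltW ta) l3 (lexx a) (or_intror (or_introl t0)).
have := Z _ _ _ _ l3 (lexx a) l3 (lexx a) (or_introl (or_introl t0)).
have := eA t t1; have := eA (- t) t2; have := eB t t1; have := eB (- t) t2.
move: te; clear; do 4 (move=> + /ler_normlP[? ?]); move=> *.
by apply/ler_normlP; split; lra.
Qed.

Lemma increment_le (F f : R -> R) (a b c : R) : a <= b ->
  (forall x, a <= x <= b -> is_derive x 1 F (f x)) ->
  (forall x, a <= x <= b -> f x <= c) -> F b - F a <= c * (b - a).
Proof.
move=> ab dF fc.
have [x||x xab ->] := @MVT_segment _ F f a b ab.
- move=> xab; apply: dF; move: xab; rewrite in_itv /= => /andP[? ?].
  by rewrite !ltW.
- apply: derivable_within_continuous => x; rewrite in_itv /= => /dF dx.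
  exact: ex_derive.
- by rewrite ler_wpM2r ?subr_ge0// fc.
Qed.

Lemma continuousR_eps (f : R -> R) :
  (forall x e, 0 < e -> exists2 r, 0 < r & forall y, `|y - x| < r -> `|f y - f x| < e) ->
  continuous f.
Proof.
move=> H x; apply/cvgrPdist_lt => e e0; have [r r0 Hr] := H x e e0.
apply/nbhs_ballP; exists r => //= y; rewrite /ball /= => xy.
by rewrite distrC Hr// distrC.
Qed.

(** This is the real part of (u + iv) / (a + it), with u + iv the value of [h - 1] on a side of the
    square of half-side [a]: the numerator is at most [- a / 2], the denominator at most
    [2 * a ^+ 2]. *)
Lemma edge_bound (a t u v : R) : 0 < a -> `|t| <= a -> u <= - (3 / 4) -> `|v| <= 1 / 4 ->
  (u * a + v * t) / (a ^+ 2 + t ^+ 2) <= - (4 * a)^-1.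
Proof.
move=> a0 ta u1 v1.
have t2 : t ^+ 2 <= a ^+ 2 by rewrite -(real_normK (num_real t)) lerXn2r// nnegrE ?ltW.
have vt : v * t <= 1 / 4 * a.
  by apply: le_trans (ler_norm _) _; rewrite normrM ler_pM.
have D : 0 < a ^+ 2 + t ^+ 2 by rewrite ltr_wpDr ?sqr_ge0// exprn_gt0.
rewrite ler_pdivrMr// mulNr lerNr mulrC ler_pdivrMr ?mulr_gt0//; nra.
Qed.
End Square.

(** * The maximum principle *)

Section CauchySquare.
Variable R : realType.
Implicit Types (z w : C R) (f h : C R -> C R).

(** The value at [z] is a parameter, so that the same function serves where [f] is differentiable at
    [z] and where the limit of the quotient is still to be found. *)
Definition slope f z (d : C R) w : C R :=
  if w == z then d else (f w - f z) * (w - z)^-1.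

Lemma slope_continuous f z : holo f z ->
  exists d, {for z, continuous (slope f z d)}.
Proof.
move=> /holo_cmod[d H]; exists d; apply/continuousC_eps => e e0.
have [|r r0 Hr] := H (e / 2); first by lra.
exists r => // w wz; rewrite {2}/slope eqxx /slope.
case: eqVneq => [_|wnz]; first by rewrite subrr cmod0.
have D : 0 < cmod (w - z) by rewrite lt_def cmod_ge0 cmod_eq0 subr_eq0 wnz.
have -> : (f w - f z) * (w - z)^-1 - d = (f w - f z - d * (w - z)) * (w - z)^-1.
  by rewrite [RHS]mulrBl mulfK// subr_eq0.
rewrite cmodM cmodV ltr_pdivrMr//; apply: le_lt_trans (Hr _ wz) _.
by rewrite ltr_pM2r//; lra.
Qed.

Lemma slope_holo f z d w : w != z -> holo f w -> holo (slope f z d) w.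
Proof.
move=> wz fw; have D : 0 < cmod (w - z) by rewrite lt_def cmod_ge0 cmod_eq0 subr_eq0 wz.
apply: (@holo_near _ (fun w => (f w - f z) * (w - z)^-1)).
  apply/nbhs_cmodP; exists (cmod (w - z)) => // v vw; rewrite /slope.
  by case: eqVneq vw => // ->; rewrite cmodB ltxx.
apply: holoM; first by apply: holoB => //; exact: holo_cst.
by apply: holoV; [rewrite subr_eq0|exact: holo_subid].
Qed.

(* Precomposing with [clamp] extends a function continuous on a square to one that is
   continuous everywhere, hence has primitives. *)
Definition clamp (b x : R) : R := Num.max (- b) (Num.min x b).

Lemma clamp_id b x : `|x| <= b -> clamp b x = x.
Proof. by rewrite ler_norml => /andP[? ?]; rewrite /clamp (min_idPl _)// (max_idPr _). Qed.

Lemma clamp_le b x : 0 <= b -> `|clamp b x| <= b.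
Proof.
move=> b0; rewrite ler_norml /clamp le_max lexx /= ge_max ge_min lexx orbT andbT; lra.
Qed.

Lemma clamp_lip b x y : `|clamp b x - clamp b y| <= `|x - y|.
Proof.
apply/ler_normlP; rewrite /clamp; have /ler_normlP[? ?] := lexx `|x - y|.
by case: (leP x b) => ?; case: (leP y b) => ?; case: (leP (- b) x) => ?;
  case: (leP (- b) y) => ?; case: (leP (- b) b) => ?; split; lra.
Qed.

Lemma mkC_neq0 (s t : R) : (s != 0) || (t != 0) -> mkC s t != 0.
Proof.
move=> st; rewrite -cmod_eq0 -sqrf_eq0 cmod_sqr cre_mk cim_mk.
by rewrite paddr_eq0 ?sqr_ge0// !sqrf_eq0 negb_and.
Qed.

Lemma cre_cim_div (u v s t : R) : (s != 0) || (t != 0) ->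
  let k := mkC u v * (mkC s t)^-1 in
  cre k = (u * s + v * t) / (s ^+ 2 + t ^+ 2) /\ cim k = (v * s - u * t) / (s ^+ 2 + t ^+ 2).
Proof.
move=> st k.
have kE : k * mkC s t = mkC u v by rewrite /k mulfVK// mkC_neq0.
have D : s ^+ 2 + t ^+ 2 != 0.
  by rewrite paddr_eq0 ?sqr_ge0// !sqrf_eq0 negb_and.
have uE : u = cre k * s - cim k * t by rewrite -[u](cre_mk u v) -kE creM cre_mk cim_mk.
have vE : v = cre k * t + cim k * s by rewrite -[v](cim_mk u v) -kE cimM cre_mk cim_mk.
by split; apply: (mulIf D); rewrite divfK// {1}uE {1}vE; ring.
Qed.

(* Otherwise the form [Im (k dz)] with [k z := (h z - 1) / (z - z0)] has zero integral
   along the boundary of the square, although it is negative on each side. *)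
Lemma square_estimate h z0 (a : R) : 0 < a ->
  (forall s t : R, `|s| <= 2 * a -> `|t| <= 2 * a -> holo h (z0 + mkC s t)) ->
  (forall s t : R, `|s| <= a -> `|t| <= a -> (`|s| == a) || (`|t| == a) ->
     cmod (h (z0 + mkC s t)) <= 1 / 4) ->
  h z0 != 1.
Proof.
move=> a0 hh hb; apply/eqP => hz0.
have mkC00 : mkC 0 0 = 0 :> C R by apply/eqP; rewrite -cmod_eq0 cmod_real.
have hz : holo h z0.
  by have := hh 0 0; rewrite mkC00 addr0; apply; rewrite normr0; lra.
have [d cd] := slope_continuous hz.
pose k := slope h z0 d.
have ptN s t : (s != 0) || (t != 0) -> z0 + mkC s t != z0.
  by move=> /mkC_neq0; rewrite -[z0 + _ == _]subr_eq0 addrAC subrr add0r.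
have ck (s t : R) : `|s| <= 2 * a -> `|t| <= 2 * a -> {for z0 + mkC s t, continuous k}.
  move=> hs ht; case: (boolP ((s != 0) || (t != 0))) => [st|].
    by apply: holo_continuous; apply: slope_holo; [exact: ptN|exact: hh].
  by rewrite negb_or !negbK => /andP[/eqP -> /eqP ->]; rewrite mkC00 addr0.
pose K s t := k (z0 + mkC (clamp (2 * a) s) (clamp (2 * a) t)).
have a20 : 0 <= 2 * a by lra.
have Keps s t e : 0 < e -> exists2 r, 0 < r & forall s' t', `|s' - s| + `|t' - t| < r ->
    cmod (K s' t' - K s t) < e.
  have /continuousC_eps/(_ e) := ck _ _ (clamp_le s a20) (clamp_le t a20).
  move=> /[apply] -[r r0 Hr]; exists r => // s' t' st; apply: Hr.
  rewrite opprD addrACA subrr add0r; apply: le_lt_trans (cmod_mkB _ _ _ _) _.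
  by apply: le_lt_trans (lerD (clamp_lip _ _ _) (clamp_lip _ _ _)) st.
(* Im (k dz) = Im k dx + Re k dy. *)
pose p s t := cim (K s t); pose q s t := cre (K s t).
have cp t : continuous (p^~ t).
  apply: continuousR_eps => s e /(Keps s t)[r r0 Hr]; exists r => // s' ss'.
  rewrite /p -cimN -cimD; apply: le_lt_trans (cim_le_cmod _) _.
  by apply: Hr; rewrite subrr normr0 addr0.
have cq s : continuous (q s).
  apply: continuousR_eps => t e /(Keps s t)[r r0 Hr]; exists r => // s' ss'.
  rewrite /q -creN -creD; apply: le_lt_trans (cre_le_cmod _) _.
  by apply: Hr; rewrite subrr normr0 add0r.
have /choice[A dA] t := continuous_primitive (- (2 * a)) (cp t).
have /choice[B dB] s := continuous_primitive (- (2 * a)) (cq s).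
have dAB (s t : R) : `|s| <= a -> `|t| <= a ->
    is_derive s 1 (fun s => A t s) (p s t) /\ is_derive t 1 (B s) (q s t).
  by rewrite !ler_norml => sa ta; split; [apply: dA|apply: dB]; lra.
have Kin (s t : R) : `|s| <= 2 * a -> `|t| <= 2 * a -> K s t = k (z0 + mkC s t).
  by move=> ? ?; rewrite /K !clamp_id.
unshelve epose proof (@goursat_punctured R p q (fun s t => A t s) B a (cmod d + 1)
  a0 dAB _ _) as loop0.
- move=> s t sa ta st.
  have sa2 : `|s| < 2 * a by apply: le_lt_trans sa _; lra.
  have ta2 : `|t| < 2 * a by apply: le_lt_trans ta _; lra.
  have /holo_cmod[d' H] : holo k (z0 + mkC s t).
    by apply: slope_holo; [exact: ptN|apply: hh; exact: ltW].
  (* Cauchy-Riemann: the derivative of [k] along [y] is [d'] times the imaginary unit, so both cross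
     partials equal Re d'. *)
  exists (cim d'), (cre d'), (- cim d') => e e0; have [r r0 Hr] := H e e0.
  (* The last two bounds keep [s'] and [t'] within [2 * a], where clamping does nothing and [K]
     agrees with [k]. *)
  exists (Num.min (r / 2) (Num.min (2 * a - `|s|) (2 * a - `|t|))).
    by rewrite !lt_min !subr_gt0 sa2 ta2 divr_gt0.
  move=> s' t'; rewrite !lt_min => /and3P[s1 s2 _] /and3P[t1 _ t2].
  have s'a : `|s'| <= 2 * a.
    by have := ler_normD (s' - s) s; rewrite subrK; lra.
  have t'a : `|t'| <= 2 * a.
    by have := ler_normD (t' - t) t; rewrite subrK; lra.
  have lew : cmod (z0 + mkC s' t' - (z0 + mkC s t)) <= `|s' - s| + `|t' - t|.
    by rewrite opprD addrACA subrr add0r; exact: cmod_mkB.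
  have /Hr HH : cmod (z0 + mkC s' t' - (z0 + mkC s t)) < r by lra.
  have {}HH := le_trans HH (ler_wpM2l (ltW e0) lew).
  rewrite /p /q !Kin ?(ltW sa2) ?(ltW ta2)//.
  move: HH; rewrite (_ : z0 + mkC s' t' - (z0 + mkC s t) = mkC s' t' - mkC s t); last first.
    by rewrite opprD addrACA subrr add0r.
  move: (k _) (k _) => k1 k2 HH; split.
  + apply: le_trans HH; apply: le_trans (cim_le_cmod _).
    rewrite !(cimD, cimN, cimM, creD, creN) !cre_mk !cim_mk.
    by rewrite le_eqVlt; apply/orP; left; apply/eqP; congr (`|_|); ring.
  + apply: le_trans HH; apply: le_trans (cre_le_cmod _).
    rewrite !(creD, creN, creM, cimD, cimN) !cre_mk !cim_mk.
    by rewrite le_eqVlt; apply/orP; left; apply/eqP; congr (`|_|); ring.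
- have [|r r0 Hr] := Keps 0 0 1; first by [].
  exists (r / 2); first by lra.
  move=> s t sr tr.
  have := Hr s t; rewrite !subr0 (_ : K 0 0 = d); last first.
    by rewrite Kin ?normr0// mkC00 addr0 /k /slope eqxx.
  move=> /(_ ltac:(lra)) H.
  have KM : cmod (K s t) <= cmod d + 1.
    by have := cmodD (K s t - d) d; rewrite subrK; lra.
  by split; apply: le_trans KM; [exact: cim_le_cmod|exact: cre_le_cmod].
have Kb (s t : R) : `|s| <= a -> `|t| <= a -> (`|s| == a) || (`|t| == a) ->
    exists u v : R, [/\ u <= - (3 / 4), `|v| <= 1 / 4,
      q s t = (u * s + v * t) / (s ^+ 2 + t ^+ 2) &
        p s t = (v * s - u * t) / (s ^+ 2 + t ^+ 2)].
  move=> sa ta st; have st0 : (s != 0) || (t != 0).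
    by case/orP: st => /eqP E; rewrite -(normr_eq0 s) -(normr_eq0 t) E (gt_eqF a0) ?orbT.
  exists (cre (h (z0 + mkC s t) - 1)), (cim (h (z0 + mkC s t) - 1)).
  have Hb := hb _ _ sa ta st.
  rewrite creD cimD creN cimN cre1 cim1 subr0.
  have re4 := le_trans (cre_le_cmod _) Hb; have im4 := le_trans (cim_le_cmod _) Hb.
  move/ler_normlP: re4 => [? ?].
  have [] := cre_cim_div (cre (h (z0 + mkC s t) - 1)) (cim (h (z0 + mkC s t) - 1)) st0.
  rewrite mkC_re_im.
  have -> : (h (z0 + mkC s t) - 1) * (mkC s t)^-1 = K s t.
    rewrite Kin; [|lra..]; rewrite /k /slope (negbTE (ptN _ _ st0)) hz0.
    by rewrite addrAC subrr add0r.
  rewrite creD cimD creN cimN cre1 cim1 subr0 => qE pE.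
  by split => //; lra.
have aa : `|a| = a by rewrite gtr0_norm.
have naa : `|- a| = a by rewrite normrN.
have lx (x : R) : - a <= x <= a -> `|x| <= a by rewrite ler_norml.
have bot := @increment_le R (A (- a)) (p^~ (- a)) (- a) a (- (4 * a)^-1).
have top := @increment_le R (fun s => - A a s) (fun s => - p s a) (- a) a (- (4 * a)^-1).
have rgt := @increment_le R (B a) (q a) (- a) a (- (4 * a)^-1).
have lft := @increment_le R (fun t => - B (- a) t) (fun t =>
  - q (- a) t) (- a) a (- (4 * a)^-1).
have {}bot : A (- a) a - A (- a) (- a) <= - (4 * a)^-1 * (a - - a).
  apply: bot; first by lra.
    by move=> x xa; apply: (proj1 (dAB _ _ _ _)); rewrite ?naa//; exact: lx.
  move=> x xa; have [|||u [v [hu hv _ ->]]] := Kb x (- a); rewrite ?naa ?eqxx ?orbT//.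
    exact: lx.
  have -> : v * x - u * - a = u * a + v * x by ring.
  have -> : x ^+ 2 + (- a) ^+ 2 = a ^+ 2 + x ^+ 2 by ring.
  by apply: edge_bound => //; exact: lx.
have {}top : - A a a - - A a (- a) <= - (4 * a)^-1 * (a - - a).
  apply: top; first by lra.
    by move=> x xa; apply: is_deriveN; apply: (proj1 (dAB _ _ _ _)); rewrite ?aa//; exact: lx.
  move=> x xa; have [|||u [v [hu hv _ ->]]] := Kb x a; rewrite ?aa ?eqxx ?orbT//.
    exact: lx.
  rewrite -mulNr.
  have -> : - (v * x - u * a) = u * a + (- v) * x by ring.
  have -> : x ^+ 2 + a ^+ 2 = a ^+ 2 + x ^+ 2 by ring.
  by apply: edge_bound => //; [exact: lx|rewrite normrN].
have {}rgt : B a a - B a (- a) <= - (4 * a)^-1 * (a - - a).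
  apply: rgt; first by lra.
    by move=> x xa; apply: (proj2 (dAB _ _ _ _)); rewrite ?aa//; exact: lx.
  move=> x xa; have [|||u [v [hu hv -> _]]] := Kb a x; rewrite ?aa ?eqxx ?orbT//.
    exact: lx.
  by apply: edge_bound => //; exact: lx.
have {}lft : - B (- a) a - - B (- a) (- a) <= - (4 * a)^-1 * (a - - a).
  apply: lft; first by lra.
    by move=> x xa; apply: is_deriveN; apply: (proj2 (dAB _ _ _ _)); rewrite ?naa//; exact: lx.
  move=> x xa; have [|||u [v [hu hv -> _]]] := Kb (- a) x; rewrite ?naa ?eqxx ?orbT//.
    exact: lx.
  rewrite -mulNr.
  have -> : - (u * - a + v * x) = u * a + (- v) * x by ring.
  have -> : (- a) ^+ 2 + x ^+ 2 = a ^+ 2 + x ^+ 2 by ring.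
  by apply: edge_bound => //; [exact: lx|rewrite normrN].
(* Each of the four sides contributes at most [- (1 / 2)], whereas the loop is zero. *)
have E : - (4 * a)^-1 * (a - - a) = - (1 / 2) by field; lra.
rewrite {}E in bot top rgt lft; move: loop0 bot top rgt lft; clear => *; lra.
Qed.

End CauchySquare.

(** * From the square estimate to the maximum principle *)

Section MaximumPrinciple.
Variable R : realType.
Implicit Types (z w : C R) (f : C R -> C R) (U K : set (C R)).

Lemma continuous_mkC : continuous (fun p : R * R => mkC p.1 p.2).
Proof.
move=> p A /nbhs_cmodP[r r0 Hr]; apply/nbhs_ballP; exists (r / 2) => /=; first by lra.
move=> q [/= q1 q2]; apply: Hr; apply: le_lt_trans (cmod_mkB _ _ _ _) _.
move: q1 q2; rewrite /ball /= => q1 q2.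
by rewrite distrC [X in _ + X]distrC; lra.
Qed.

Lemma compactC K (b : R) : (forall z, K z -> cmod z <= b) ->
  (forall z, (forall r : R, 0 < r -> exists2 w, K w & cmod (w - z) < r) -> K z) ->
  compact K.
Proof.
move=> Kb Kcl.
pose box := (fun p : R * R => mkC p.1 p.2) @` (`[- b, b] `*` `[- b, b]).
apply: (@subclosed_compact _ _ box).
- move=> z /= cz; apply: Kcl => r r0.
  have : nbhs z [set w : C R | cmod (w - z) < r] by apply/nbhs_cmodP; exists r.
  by move=> /cz[w [Kw wz]]; exists w.
- apply: continuous_compact.
    by apply: continuous_subspaceT; exact: continuous_mkC.
  by apply: compact_setX; exact: segment_compact.
- move=> z Kz; exists (cre z, cim z); last exact: mkC_re_im.
  by split; rewrite /= in_itv /= -ler_norml; apply: le_trans (Kb _ Kz);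
    [exact: cre_le_cmod|exact: cim_le_cmod].
Qed.

Lemma continuous_cmod : continuous (@cmod R).
Proof.
move=> z A /nbhs_ballP[e /= e0 He]; apply/nbhs_cmodP; exists e => // w wz.
apply: He; rewrite /ball /=; apply: le_lt_trans wz.
by rewrite ler_norml lerNl opprB cmodB_ge cmodB cmodB_ge.
Qed.

Lemma expr_small (x e : R) : 0 <= x < 1 -> 0 < e -> exists n, x ^+ n <= e.
Proof.
move=> /andP[x0 x1] e0.
have : x ^+ n @[n --> \oo] --> 0 by apply: cvg_expr; rewrite ger0_norm.
move=> /cvgrPdist_le/(_ e e0)[n _ Hn]; exists n.
have := Hn n (leqnn n); rewrite sub0r normrN.
by apply: le_trans; exact: ler_norm.
Qed.

(** Lagrange's identity for the vectors (f, sqrt e w, 1) and (f0, sqrt e w0, 1). Of the three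
    squares, the one from the last two coordinates is kept: it makes the inequality strict for [w]
    away from [w0]. *)
Lemma lagrange_bound (f f0 w w0 : C R) (e : R) : 0 <= e ->
  cmod (f * f0^* + mkC e 0 * w * w0^* + 1) ^+ 2 + e * cmod (w - w0) ^+ 2 <=
  (cmod f ^+ 2 + e * cmod w ^+ 2 + 1) * (cmod f0 ^+ 2 + e * cmod w0 ^+ 2 + 1).
Proof.
move=> e0; rewrite -subr_ge0.
set L := _ - _; suff -> : L = cmod (f - f0) ^+ 2 + e * cmod (f * w0 - w * f0) ^+ 2.
  by rewrite addr_ge0 ?sqr_ge0// mulr_ge0 ?sqr_ge0.
rewrite /L !cmod_sqr !(creD, cimD, creN, cimN, creM, cimM, cre_conj, cim_conj) cre_mk
  cim_mk cre1 cim1.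
by ring.
Qed.

(* At a maximum [z0] of [|f|^2 + eps |z|^2], Cauchy-Schwarz with the extra coordinate [1]
   is strict away from [z0]: the holomorphic [h] satisfies [|h| < h z0] there. *)
Lemma maximum_principle U f (M b : R) : open U -> (forall z, U z -> cmod z <= b) ->
  0 <= M -> (forall z, U z -> holo f z) ->
  (forall z, ~ U z -> forall e : R, 0 < e -> exists2 r : R, 0 < r &
     forall w, U w -> cmod (w - z) < r -> cmod (f w) <= M + e) ->
  forall z, U z -> cmod (f z) <= M.
Proof.
move=> oU Ub M0 fU fM z1 Uz1; rewrite leNgt; apply/negP => Mz1.
(* Near points outside [U] one has |f| <= m, so [u] is at most [m ^+ 2 + e * b ^+ 2]; [e] is chosen
   to keep this below [cmod (f z1) ^+ 2]. Hence the superlevel set [K] is closed in the plane. *)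
pose m := (M + cmod (f z1)) / 2.
pose T := cmod (f z1) ^+ 2 - m ^+ 2.
have Mm : M < m by rewrite /m; lra.
have mz1 : m < cmod (f z1) by rewrite /m; lra.
have T0 : 0 < T by rewrite /T; nra.
have b21 : 0 < b ^+ 2 + 1 by have := sqr_ge0 b; lra.
pose e := T / (b ^+ 2 + 1).
have e0 : 0 < e by rewrite divr_gt0.
have eb : e * b ^+ 2 < T.
  by rewrite /e mulrAC ltr_pdivrMr// ltr_pM2l//; lra.
pose u z := cmod (f z) ^+ 2 + e * cmod z ^+ 2.
have cu z : U z -> {for z, continuous u}.
  move=> Uz; apply: continuousD.
    apply: continuousM; apply: continuous_comp; try exact: continuous_cmod.
      by apply: holo_continuous; exact: fU.
    by apply: holo_continuous; exact: fU.
  apply: continuousM; first exact: cst_continuous.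
  by apply: continuousM; exact: continuous_cmod.
pose K := [set z | U z /\ u z1 <= u z].
have cK : compact K.
  apply: (compactC (b := b)); first by move=> z [/Ub].
  move=> z zK; case: (pselect (U z)) => [Uz|nUz].
    split => //; rewrite leNgt; apply/negP => uz.
    have /(cu _ Uz)/nbhs_cmodP[r r0 Hr] : nbhs (u z) [set x : R | x < u z1].
      apply/nbhs_ballP; exists (u z1 - u z); first by rewrite /= subr_gt0.
      by move=> y; rewrite /ball /= => /ltr_normlP[? ?]; lra.
    by have [w [_ uw] wz] := zK _ r0; have := Hr _ wz; rewrite /= ltNge uw.
  exfalso; have [|r r0 Hr] := fM _ nUz (m - M); first by lra.
  have [w [Uw uw] wz] := zK _ r0.
  have fw : cmod (f w) <= m by have := Hr _ Uw wz; rewrite addrC subrK.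
  have : u w < u z1.
    have := Ub _ Uw; have := cmod_ge0 w; have := cmod_ge0 (f w); have := cmod_ge0 z1.
    rewrite /u => ? ? ? ?.
    have ? : cmod (f w) ^+ 2 <= m ^+ 2 by rewrite lerXn2r// nnegrE; lra.
    have ? : e * cmod w ^+ 2 <= e * b ^+ 2 by rewrite (ler_wpM2l (ltW e0))// lerXn2r//
      nnegrE; lra.
    have ? : 0 <= e * cmod z1 ^+ 2 by rewrite mulr_ge0 ?sqr_ge0// ltW.
    by move: eb; rewrite /T; lra.
  by rewrite ltNge uw.
have [||z0] := @compact_EVT_max _ R u K _ cK.
- by exists z1.
- by apply: continuous_in_subspaceT => z; rewrite inE => -[/cu].
rewrite inE => -[Uz0 uz01] z0max.
have {}z0max z : U z -> u z <= u z0.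
  move=> Uz; case: (leP (u z1) (u z)) => [uz|/ltW uz]; last exact: le_trans uz uz01.
  by apply: z0max; rewrite inE.
have [r r0 Hr] : exists2 r : R, 0 < r & forall w, cmod (w - z0) < r -> U w.
  by apply/nbhs_cmodP; exact: open_nbhs_nbhs.
(* The squared length of the vector (f z0, sqrt e z0, 1); [num w] is the Hermitian product of the
   corresponding vector at [w] with it, so [num z0] is [S]. *)
pose S := u z0 + 1.
have S0 : 0 < S.
  by rewrite /S /u; have := sqr_ge0 (cmod (f z0));
    have := mulr_ge0 (ltW e0) (sqr_ge0 (cmod z0)); lra.
pose num w := f w * (f z0)^* + mkC e 0 * w * z0^* + 1.
have num0 : num z0 = mkC S 0.
  rewrite -[num z0]mkC_re_im; congr mkC; rewrite /S /u ?cmod_sqr /num;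
  rewrite !(creD, cimD, creM, cimM, cre_conj, cim_conj, cre_mk, cim_mk, cre1, cim1); ring.
have SC : mkC S 0 != 0 :> C R by rewrite -cmod_eq0 cmod_real ?gt_eqF// ltW.
(* The square estimate needs holomorphy up to half-side [2 * a], where |s| + |t| is at most
   [r / 2]. *)
pose a := r / 8.
have a0 : 0 < a by rewrite /a; lra.
pose rho := 1 - e * a ^+ 2 / S ^+ 2.
have hrho w : U w -> a <= cmod (w - z0) -> cmod (num w * (mkC S 0)^-1) ^+ 2 <= rho.
  move=> Uw aw; rewrite cmodM cmodV (cmod_real (ltW S0)) exprMn exprVn ler_pdivrMr
    ?exprn_gt0//.
  rewrite mulrBl mul1r divfK ?expf_neq0 ?gt_eqF// lerBrDr.
  have := lagrange_bound (f w) (f z0) w z0 (ltW e0); rewrite -/(u w) -/(u z0) -/S.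
  move=> lb; have : (u w + 1) * S <= S ^+ 2.
    by rewrite expr2 (ler_wpM2r (ltW S0))// lerD2r z0max.
  have a2 : a ^+ 2 <= cmod (w - z0) ^+ 2.
    by rewrite lerXn2r ?nnegrE ?cmod_ge0 ?(ltW a0).
  by apply: le_trans; apply: le_trans lb; rewrite lerD2l (ler_wpM2l (ltW e0)).
have rho1 : rho < 1.
  rewrite /rho ltrBlDr ltrDl; apply: divr_gt0; last exact: exprn_gt0.
  by apply: mulr_gt0 => //; exact: exprn_gt0.
have rho0 : 0 <= rho.
  have ca : cmod (z0 + mkC a 0 - z0) = a by rewrite addrAC subrr add0r cmod_real// ltW.
  have Ua : U (z0 + mkC a 0) by apply: Hr; rewrite ca /a; lra.
  by apply: le_trans (hrho _ Ua _); rewrite ?sqr_ge0 ?ca.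
(* [rho] bounds the square of the modulus, so the target is the square of [1 / 4]. *)
have [||N HN] := @expr_small rho (1 / 16).
- by rewrite rho0 rho1.
- by lra.
have inU (s t : R) : `|s| <= 2 * a -> `|t| <= 2 * a -> U (z0 + mkC s t).
  move=> sa ta; apply: Hr; rewrite addrAC subrr add0r; apply: le_lt_trans (cmod_le_sum _) _.
  rewrite cre_mk cim_mk; apply: le_lt_trans (lerD sa ta) _; rewrite /a; lra.
apply: (elimN eqP (@square_estimate R (fun w => (num w * (mkC S 0)^-1) ^+ N) z0 a a0 _ _)).
- move=> s t sa ta; apply: holoX; apply: holoM; last exact: holo_cst.
  apply: holoD; last exact: holo_cst.
  apply: holoD; first by apply: holoM; [apply: fU; exact: inU|exact: holo_cst].
  by apply: holoM; [apply: holoM; [exact: holo_cst|exact: holo_id]|exact: holo_cst].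
- move=> s t sa ta st.
  have aw : a <= cmod (z0 + mkC s t - z0).
    rewrite addrAC subrr add0r; case/orP: st => /eqP <-.
      by apply: le_trans (cre_le_cmod _); rewrite cre_mk.
    by apply: le_trans (cim_le_cmod _); rewrite cim_mk.
  have /hrho/(_ aw) E : U (z0 + mkC s t) by apply: inU; lra.
  rewrite cmodX -(@ler_pXn2r _ 2)// ?nnegrE ?exprn_ge0 ?cmod_ge0//.
  rewrite -exprM mulnC exprM; apply: le_trans (_ : rho ^+ N <= _).
    by rewrite lerXn2r// nnegrE ?sqr_ge0.
  by apply: le_trans HN _; lra.
- by rewrite num0 divff// expr1n.
Qed.

End MaximumPrinciple.

(** * Isolated singularities *)

Lemma quotient_continuous (K : numClosedFieldType) (f : K -> K) (p a : K) : p != a ->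
  {for p, continuous f} -> {for p, continuous (fun w => (f w - f a) * (w - a)^-1)}.
Proof.
move=> pa cf; apply: continuousM.
  by apply: continuousB => //; exact: cst_continuous.
apply: continuousV; first by rewrite subr_eq0.
by apply: continuousB; [exact: cvg_id|exact: cst_continuous].
Qed.

Section Removable.
Variable R : realType.
Implicit Types (z w p : C R) (f : C R -> C R) (U : set (C R)) (E : seq (C R)).

Lemma poly_bounded (q : {poly C R}) (b : R) :
  exists2 D : R, 0 <= D & forall w, cmod w <= b -> cmod q.[w] <= D.
Proof.
elim/poly_ind: q => [|q c [D D0 HD]].
  by exists 0 => // w _; rewrite horner0 cmod0.
exists (D * `|b| + cmod c); first by rewrite addr_ge0 ?mulr_ge0 ?cmod_ge0.
move=> w wb; rewrite hornerMXaddC; apply: le_trans (cmodD _ _) _; rewrite lerD2r cmodM.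
by rewrite ler_pM ?cmod_ge0 ?HD// (le_trans wb)// ler_norm.
Qed.

Lemma open_cmodP U : open U <->
  forall z, U z -> exists2 r : R, 0 < r & forall w, cmod (w - z) < r -> U w.
Proof.
rewrite openE; split => H z Uz; first by apply/nbhs_cmodP; exact: H.
by apply/nbhs_cmodP; exact: H.
Qed.

Lemma cmod_gt0 z : (0 < cmod z) = (z != 0).
Proof. by rewrite lt_def cmod_ge0 cmod_eq0 andbT. Qed.

(* The exceptional points are removed by applying the maximum principle to
   [f ^+ N * prod_(a in E) (z - a)] and letting [N] tend to infinity. *)
Lemma maximum_principle_punctured U f E (M b : R) : open U ->
  (forall z, U z -> cmod z <= b) -> 0 <= M ->
  (forall z, U z -> z \notin E -> holo f z) ->
  (forall z, z \in E -> exists B r : R, 0 < r /\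
     forall w, U w -> w \notin E -> cmod (w - z) < r -> cmod (f w) <= B) ->
  (forall z, ~ U z -> forall e : R, 0 < e -> exists2 r : R, 0 < r &
     forall w, U w -> w \notin E -> cmod (w - z) < r -> cmod (f w) <= M + e) ->
  forall z, U z -> z \notin E -> cmod (f z) <= M.
Proof.
move=> oU Ub M0 fU fE fM z1 Uz1 Ez1.
apply/ler_addgt0Pr => e e0; set M' := M + e.
have M'0 : 0 < M' by rewrite /M'; lra.
pose om : {poly C R} := \prod_(a <- E) ('X - a%:P).
have om0 w : (om.[w] == 0) = (w \in E) by rewrite -root_prod_XsubC.
have hom w : holo (fun w => om.[w]) w by apply: holo_horner; exact: holo_id.
have [D D0 HD] := poly_bounded om b.
have com w e' : 0 < e' -> exists2 r : R, 0 < r & forall v, cmod (v - w) < r ->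
  cmod (om.[v] - om.[w]) < e'.
  by have /holo_continuous/continuousC_eps := hom w; apply.
pose V := [set z | U z /\ z \notin E].
have oV : open V.
  apply/open_cmodP => z [Uz Ez]; have [r r0 Hr] := (open_cmodP U).1 oU z Uz.
  have [|s s0 Hs] := com z (cmod om.[z]); first by rewrite cmod_gt0 om0.
  exists (Num.min r s); first by rewrite lt_min r0.
  move=> w; rewrite lt_min => /andP[wr ws]; split; first exact: Hr.
  rewrite -om0; apply/eqP => ow; have := Hs w ws.
  by rewrite ow sub0r cmodN ltxx.
have key N : cmod (f z1) ^+ N * cmod om.[z1] <= M' ^+ N * D.
  rewrite -cmodX -cmodM.
  apply: (@maximum_principle R V (fun w => f w ^+ N * om.[w]) _ b) => //.
  - by move=> z [/Ub].
  - by rewrite mulr_ge0// exprn_ge0// ltW.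
  - by move=> z [Uz Ez]; apply: holoM => //; apply: holoX; exact: fU.
  move=> z nVz e' e'0; case: (pselect (U z)) => Uz; last first.
    have [r r0 Hr] := fM z Uz e e0; exists r => // w [Uw Ew] wz.
    rewrite cmodM cmodX; apply: le_trans (_ : M' ^+ N * D <= _); last by rewrite lerDl ltW.
    by rewrite ler_pM ?exprn_ge0 ?cmod_ge0 ?HD ?Ub// lerXn2r ?nnegrE ?cmod_ge0 ?(ltW M'0)// Hr.
  (* At an exceptional point [om] vanishes while |f| is at most [B], so the product tends to zero
     there. *)
  have Ez : z \in E by apply: contrapT => /negP Ez; exact: nVz.
  have [B [r [r0 Hr]]] := fE z Ez.
  have B1 : 0 < `|B| ^+ N + 1 by rewrite ltr_wpDl// exprn_ge0.
  have [|s s0 Hs] := com z (e' / (`|B| ^+ N + 1)); first exact: divr_gt0.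
  exists (Num.min r s); first by rewrite lt_min r0.
  move=> w [Uw Ew]; rewrite lt_min => /andP[wr ws].
  have := Hs w ws; rewrite (_ : om.[z] = 0) ?subr0; last by apply/eqP; rewrite om0.
  rewrite ltr_pdivlMr// => lt.
  apply: le_trans (_ : e' <= _); last by rewrite lerDr mulr_ge0// exprn_ge0// ltW.
  apply: le_trans (ltW lt); rewrite cmodM cmodX mulrC ler_wpM2l ?cmod_ge0//.
  apply: le_trans (_ : `|B| ^+ N <= _); last by rewrite lerDl.
  rewrite lerXn2r ?nnegrE ?cmod_ge0//; apply: le_trans (ler_norm _); exact: Hr.
(* Dividing [key N] by the [N]-th power of [cmod (f z1)] leaves a geometric decay above the fixed
   positive number [cmod om.[z1]]. In the threshold below, [D + 1] replaces [D], which may be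
   zero. *)
rewrite leNgt; apply/negP => big.
have f0 : 0 < cmod (f z1) by apply: lt_trans big.
have o0 : 0 < cmod om.[z1] by rewrite cmod_gt0 om0.
have [||N HN] := @expr_small R (M' / cmod (f z1)) (cmod om.[z1] / (2 * (D + 1))).
- by rewrite divr_ge0 ?ltW//= ltr_pdivrMr// mul1r.
- by rewrite divr_gt0//; lra.
have fN : 0 < cmod (f z1) ^+ N by exact: exprn_gt0.
move: HN; rewrite expr_div_n ler_pdivrMr// mulrAC ler_pdivlMr; last by lra.
move=> HN; have kN := key N; have := mulr_gt0 o0 fN.
have := ltW (exprn_gt0 N M'0).
by move: HN kN; rewrite mulrC [_ * cmod (f z1) ^+ N]mulrC => HN kN; nra.
Qed.

(** The limit is obtained as the lower limit at [p]: the supremum of the numbers that bound [g] from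
    below on some punctured disc. *)
Lemma cauchy_limitR (g : C R -> R) p :
  (forall e : R, 0 < e -> exists2 r : R, 0 < r & forall z w, z != p -> w != p ->
     cmod (z - p) < r -> cmod (w - p) < r -> g z - g w <= e) ->
  exists d : R, forall e : R, 0 < e -> exists2 r : R, 0 < r &
    forall z, z != p -> cmod (z - p) < r -> `|g z - d| <= e.
Proof.
move=> H.
have pt (r : R) : 0 < r -> exists2 z, z != p & cmod (z - p) < r.
  move=> r0; have E : cmod (p + mkC (r / 2) 0 - p) = r / 2.
    by rewrite addrAC subrr add0r cmod_real//; lra.
  exists (p + mkC (r / 2) 0); last by rewrite E; lra.
  by rewrite -subr_eq0 -cmod_eq0 E gt_eqF//; lra.
pose A := [set x : R | exists2 r : R, 0 < r & forall z, z != p -> cmod (z - p) < r ->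
  x <= g z].
have Aub (e r : R) : (forall z w, z != p -> w != p ->
     cmod (z - p) < r -> cmod (w - p) < r -> g z - g w <= e) -> 0 < r -> forall z, z != p ->
     cmod (z - p) < r -> ubound A (g z + e).
  move=> Hr r0 z zp zr x [s s0 Hs].
  have [|w wp] := pt (Num.min r s); first by rewrite lt_min r0.
  rewrite lt_min => /andP[wr ws]; have := Hr w z wp zp wr zr; have := Hs w wp ws; lra.
have Ain (e r : R) : (forall z w, z != p -> w != p ->
     cmod (z - p) < r -> cmod (w - p) < r -> g z - g w <= e) -> 0 < r -> forall z, z != p ->
     cmod (z - p) < r -> A (g z - e).
  move=> Hr r0 z zp zr; exists r => // w wp wr; have := Hr z w zp wp zr wr; lra.
exists (sup A) => e e0; have [r r0 Hr] := H e e0; exists r => // z zp zr.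
have [r1 r10 Hr1] := H 1 ltr01; have [z1 z1p z1r] := pt r1 r10.
apply/ler_normlP; split.
  rewrite opprB lerBlDr addrC; apply: ge_sup; first by exists (g z1 - 1); exact: Ain z1r.
  exact: Aub zr.
rewrite lerBlDr addrC -lerBlDr; apply: ub_le_sup; last exact: Ain zr.
by exists (g z1 + 1); exact: Aub z1r.
Qed.

Lemma cauchy_limit (g : C R -> C R) p :
  (forall e : R, 0 < e -> exists2 r : R, 0 < r & forall z w, z != p -> w != p ->
     cmod (z - p) < r -> cmod (w - p) < r -> cmod (g z - g w) <= e) ->
  exists d : C R, forall e : R, 0 < e -> exists2 r : R, 0 < r &
    forall z, z != p -> cmod (z - p) < r -> cmod (g z - d) < e.
Proof.
move=> H.
have [|dr Hdr] := @cauchy_limitR (fun z => cre (g z)) p.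
  move=> e /H[r r0 Hr]; exists r => // z w zp wp zr wr.
  rewrite -creN -creD; apply: le_trans (ler_norm _) (le_trans (cre_le_cmod _) _).
  exact: Hr.
have [|di Hdi] := @cauchy_limitR (fun z => cim (g z)) p.
  move=> e /H[r r0 Hr]; exists r => // z w zp wp zr wr.
  rewrite -cimN -cimD; apply: le_trans (ler_norm _) (le_trans (cim_le_cmod _) _).
  exact: Hr.
exists (mkC dr di) => e e0.
have e3 : 0 < e / 3 by lra.
have [r r0 Hr] := Hdr _ e3; have [s s0 Hs] := Hdi _ e3.
exists (Num.min r s); first by rewrite lt_min r0.
move=> z zp; rewrite lt_min => /andP[zr zs].
apply: le_lt_trans (cmod_le_sum _) _.
rewrite creD creN cimD cimN cre_mk cim_mk.
by have := Hr z zp zr; have := Hs z zp zs; lra.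
Qed.

(* The difference of the slope functions [w |-> (f w - f z) / (w - z)] at [z] and [z'] is
   small on a fixed circle around [p], hence, by the maximum principle, at [p]: so
   [z |-> (f z - f p) / (z - p)] is Cauchy at [p]. *)
Lemma removable_singularity f p (rho : R) : 0 < rho ->
  (forall z, z != p -> cmod (z - p) < rho -> holo f z) -> {for p, continuous f} ->
  exists d, {for p, continuous (slope f p d)}.
Proof.
move=> rho0 hf cf.
suff [d Hd] : exists d : C R, forall e : R, 0 < e -> exists2 r : R, 0 < r &
    forall z, z != p -> cmod (z - p) < r -> cmod ((f z - f p) * (z - p)^-1 - d) < e.
  exists d; apply/continuousC_eps => e e0; have [r r0 Hr] := Hd e e0; exists r => // w wr.
  rewrite {2}/slope eqxx /slope; case: eqVneq => [_|wp]; first by rewrite subrr cmod0.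
  exact: Hr.
apply: cauchy_limit => e e0.
have /continuousC_eps ceps := cf.
have [s s0 Hs] := ceps 1 ltr01.
pose r1 := Num.min rho s.
have r10 : 0 < r1 by rewrite lt_min rho0.
pose U := [set z | cmod (z - p) < r1].
have Uf z w : U z -> U w -> cmod (f z - f w) <= 2.
  rewrite /U /= /r1 !lt_min => /andP[_ zs] /andP[_ ws].
  have := Hs z zs; have := Hs w ws; have := cmodD (f z - f p) (f p - f w).
  by rewrite addrA subrK (cmodB (f p)); lra.
have hU z : U z -> z != p -> holo f z.
  by rewrite /U /= lt_min => /andP[zr _] zp; exact: hf.
clearbody r1.
have oU : open U.
  apply/open_cmodP => z Uz; exists (r1 - cmod (z - p)); first by rewrite subr_gt0.
  move=> w wz; have := cmodD (w - z) (z - p); rewrite addrA subrK.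
  by rewrite /U /=; lra.
have bU z : U z -> cmod z <= r1 + cmod p.
  by rewrite /U /= => Uz; have := cmodD (z - p) p; rewrite subrK; lra.
pose q z w := (f w - f z) * (w - z)^-1.
have qb z a : U z -> z != p -> exists B r : R, 0 < r /\
    forall w, U w -> w != z -> cmod (w - a) < r -> cmod (q z w) <= B.
  move=> Uz zp; have [->|az] := eqVneq a z.
    have /holo_cmod[d Hd] := hU z Uz zp; have [r r0 Hr] := Hd 1 ltr01.
    exists (1 + cmod d), r; split=> // w Uw wz wr.
    have wz0 : 0 < cmod (w - z) by rewrite cmod_gt0 subr_eq0.
    rewrite /q cmodM cmodV ler_pdivrMr//.
    have := cmodD (f w - f z - d * (w - z)) (d * (w - z)); rewrite subrK cmodM.
    by have := Hr w wr; rewrite mulrDl; lra.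
  have az0 : 0 < cmod (a - z) by rewrite cmod_gt0 subr_eq0.
  exists (2 / (cmod (a - z) / 2)), (cmod (a - z) / 2); split; first by lra.
  move=> w Uw wz wr; rewrite /q cmodM cmodV ler_pM ?invr_ge0 ?cmod_ge0 ?Uf//.
  rewrite lef_pV2 ?posrE ?cmod_gt0 ?subr_eq0//; last by rewrite divr_gt0.
  by have := cmodD (a - w) (w - z); rewrite addrA subrK (cmodB a w); lra.
(* For [w] close to the complement of [U] and [z], [z'] in the half-radius disc, |w - z| and |w -
   z'| are at least [r1 / 4]; [c] is the resulting bound for the inverse product. *)
pose c := 16 / r1 ^+ 2.
have r12 : 0 < r1 ^+ 2 by exact: exprn_gt0.
have c0 : 0 < c by rewrite divr_gt0.
have c8 : 0 < 8 * c by lra.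
have c8r : 0 < 8 * c * r1 by exact: mulr_gt0.
have [|s' s'0 Hs'] := ceps (e / (8 * c * r1)); first exact: divr_gt0.
exists (Num.min s' (Num.min (r1 / 2) (e / (8 * c)))).
  by rewrite !lt_min s'0 !divr_gt0.
move=> z z' zp z'p; rewrite !lt_min => /and3P[zs zr ze] /and3P[z's z'r z'e].
have Uz : U z by rewrite /U /=; lra.
have Uz' : U z' by rewrite /U /=; lra.
have Up : U p by rewrite /U /= subrr cmod0.
pose phi w := q z w - q z' w.
have -> : (f z - f p) * (z - p)^-1 - (f z' - f p) * (z' - p)^-1 = phi p.
  by rewrite /phi /q -(opprB (f p)) -(opprB p) invrN mulrNN -(opprB (f p) (f z')) -(opprB
    p z') invrN mulrNN.
pose E := [:: z; z'; p].
(* With common denominator (w - z) (w - z'), the numerator of [phi w] is (f w - f z) (z - z') + (f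
   z' - f z) (w - z). The tolerances [e / (8 * c)] and [e / (8 * c * r1)] make each summand of [M]
   at most [e / 2]. *)
pose M := (2 * cmod (z - z') + cmod (f z' - f z) * (2 * r1)) * c.
have Me : M <= e.
  have zz' : cmod (z - z') <= 2 * (e / (8 * c)).
    by have := cmodD (z - p) (p - z'); rewrite addrA subrK (cmodB p); lra.
  have ff' : cmod (f z' - f z) <= 2 * (e / (8 * c * r1)).
    have := cmodD (f z' - f p) (f p - f z); rewrite addrA subrK (cmodB (f p)).
    by have := Hs' z zs; have := Hs' z' z's; lra.
  have -> : e = (2 * (2 * (e / (8 * c))) + 2 * (e / (8 * c * r1)) * (2 * r1)) * c.
    by field; rewrite !gt_eqF.
  rewrite /M ler_pM2r//; apply: lerD; first by rewrite ler_pM2l.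
  by rewrite ler_pM2r// mulr_gt0.
apply: le_trans Me.
have M0 : 0 <= M.
  by rewrite /M mulr_ge0 ?(ltW c0)// addr_ge0// mulr_ge0 ?cmod_ge0//; lra.
have bd : forall w, U w -> w \notin E -> cmod (phi w) <= M.
  apply: (@maximum_principle_punctured U phi E M (r1 + cmod p)) => //.
  - move=> w Uw; rewrite !inE !negb_or => /and3P[wz wz' wp].
    have hw := hU w Uw wp.
    apply: holoB; apply: holoM.
    + by apply: holoB => //; exact: holo_cst.
    + by apply: holoV; [rewrite subr_eq0|exact: holo_subid].
    + by apply: holoB => //; exact: holo_cst.
    + by apply: holoV; [rewrite subr_eq0|exact: holo_subid].
  - move=> a _; have [B [r [r0 Hr]]] := qb z a Uz zp.
    have [B' [r' [r'0 Hr']]] := qb z' a Uz' z'p.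
    exists (B + B'), (Num.min r r'); split; first by rewrite lt_min r0.
    move=> w Uw; rewrite !inE !negb_or lt_min => /and3P[wz wz' _] /andP[wr wr'].
    by rewrite /phi; apply: le_trans (cmodD _ _) _; rewrite cmodN lerD ?Hr ?Hr'.
  - move=> a nUa e' e'0; exists (r1 / 4); first by lra.
    move=> w Uw; rewrite !inE !negb_or => /and3P[wz wz' _] wa.
    apply: le_trans (_ : M <= _); last by rewrite lerDl ltW.
    have ap : r1 <= cmod (a - p) by rewrite leNgt; apply/negP.
    have wp : 3 / 4 * r1 <= cmod (w - p).
      by have := cmodD (a - w) (w - p); rewrite addrA subrK (cmodB a w); lra.
    have far v : cmod (v - p) < r1 / 2 -> r1 / 4 <= cmod (w - v).
      by have := cmodD (w - v) (v - p); rewrite addrA subrK; lra.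
    have fz := far z zr; have fz' := far z' z'r.
    have -> : phi w = ((f w - f z) * (z - z') + (f z' - f z) * (w - z)) * ((w - z)^-1 *
      (w - z')^-1).
      by rewrite /phi /q; field; rewrite !subr_eq0 wz wz'.
    rewrite cmodM; apply: ler_pM; rewrite ?cmod_ge0//.
      apply: le_trans (cmodD _ _) _; rewrite !cmodM; apply: lerD.
        by rewrite ler_wpM2r ?cmod_ge0 ?Uf.
      rewrite ler_wpM2l ?cmod_ge0//.
      by have := cmodD (w - p) (p - z); rewrite addrA subrK (cmodB p); move: Uw;
        rewrite /U /=; lra.
    have -> : c = (r1 / 4)^-1 * (r1 / 4)^-1 by rewrite /c; field; rewrite gt_eqF.
    have r4 : 0 < r1 / 4 by lra.
    rewrite cmodM !cmodV; apply: ler_pM; rewrite ?invr_ge0 ?cmod_ge0// lef_pV2 ?posrE//; lra.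
(* As [p] belongs to [E], the bound at [p] itself is recovered by continuity of [phi], from a point
   [w] closer to [p] than [z] and [z']. *)
apply/ler_addgt0Pr => e' e'0.
have /continuousC_eps/(_ e' e'0)[r r0 Hr] : {for p, continuous phi}.
  by apply: continuousB; apply: quotient_continuous; rewrite // eq_sym.
pose t := Num.min (Num.min r r1) (Num.min (cmod (z - p)) (cmod (z' - p))) / 2.
have m0 : 0 < Num.min (Num.min r r1) (Num.min (cmod (z - p)) (cmod (z' - p))).
  by rewrite !lt_min r0 r10 !cmod_gt0 !subr_eq0 zp.
have t0 : 0 < t by rewrite divr_gt0.
have : t < Num.min (Num.min r r1) (Num.min (cmod (z - p)) (cmod (z' - p))).
  by rewrite /t; lra.
rewrite !lt_min => /andP[/andP[tr tr1] /andP[tz tz']].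
pose w := p + mkC t 0.
have wE : cmod (w - p) = t by rewrite /w addrAC subrr add0r cmod_real// ltW.
have Ew : w \notin E.
  rewrite !inE !negb_or; apply/and3P; split; apply/eqP => ww.
  - by move: tz; rewrite -ww wE ltxx.
  - by move: tz'; rewrite -ww wE ltxx.
  - by move: t0; rewrite -wE ww subrr cmod0 ltxx.
have /bd/(_ Ew) : U w by rewrite /U /= wE.
have := Hr w; rewrite wE => /(_ tr); rewrite cmodB.
by have := cmodD (phi p - phi w) (phi w); rewrite subrK; lra.
Qed.
End Removable.

(** * Finite order of zeros and poles *)

Section ZeroOrder.
Variable R : realType.
Implicit Types (z w p : C R) (f g : C R -> C R).

Lemma open_disc p (r : R) : open [set z : C R | cmod (z - p) < r].
Proof.
apply/open_cmodP => z /= zr; exists (r - cmod (z - p)); first by rewrite subr_gt0.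
by move=> w wz; have := cmodD (w - z) (z - p); rewrite addrA subrK; lra.
Qed.

Lemma continuous_bounded f p : {for p, continuous f} ->
  exists2 r : R, 0 < r & forall w, cmod (w - p) < r -> cmod (f w) <= cmod (f p) + 1.
Proof.
move=> /continuousC_eps/(_ 1 ltr01)[r r0 Hr]; exists r => // w /Hr.
by have := cmodD (f w - f p) (f p); rewrite subrK; lra.
Qed.

(* If every power of [z - p] divided [g], the maximum principle for the quotients would
   give [cmod (g z1) <= B * (2 / 3) ^+ j] for all [j] at a fixed [z1 != p]. *)
Lemma zero_order g p (rho : R) : 0 < rho ->
  (forall z, z != p -> cmod (z - p) < rho -> holo g z) ->
  (forall z, z != p -> cmod (z - p) < rho -> g z != 0) -> {for p, continuous g} ->
  exists k (c r : R), [/\ 0 < c, 0 < r &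
    forall z, z != p -> cmod (z - p) < r -> c * cmod (z - p) ^+ k <= cmod (g z)].
Proof.
move=> rho0 hg g0 cg; apply: contrapT => no.
have quot j : exists q : C R -> C R, {for p, continuous q} /\
    forall z, z != p -> cmod (z - p) < rho -> holo q z /\ g z = (z - p) ^+ j * q z.
  elim: j => [|j [q [cq Hq]]].
    by exists g; split=> // z zp zr; rewrite expr0 mul1r; split=> //; exact: hg.
  (* Were [q p] nonzero, |q| would stay above half its value near [p], giving the order [j] that is
     assumed not to exist. *)
  have q0 : q p = 0.
    apply: contrapT => /eqP q0; apply: no.
    have qp0 : 0 < cmod (q p) by rewrite cmod_gt0.
    have /continuousC_eps/(_ (cmod (q p) / 2))[|r r0 Hr] := cq; first by lra.
    exists j, (cmod (q p) / 2), (Num.min r rho); split; first by lra.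
      by rewrite lt_min r0.
    move=> z zp; rewrite lt_min => /andP[zr zrho].
    have [_ ->] := Hq z zp zrho; rewrite cmodM cmodX mulrC ler_wpM2l ?exprn_ge0 ?cmod_ge0//.
    by have := Hr z zr; have := cmodD (q p - q z) (q z); rewrite subrK (cmodB (q p)); lra.
  have [|d cd] := @removable_singularity R q p rho rho0 _ cq.
    by move=> z zp zr; have [] := Hq z zp zr.
  exists (slope q p d); split=> // z zp zr; have [hq ->] := Hq z zp zr.
  split; first exact: slope_holo.
  rewrite /slope (negbTE zp) q0 subr0 exprSr -mulrA; congr (_ * _).
  by rewrite mulrC divfK// subr_eq0.
have [s s0 Hs] := continuous_bounded cg.
set B := cmod (g p) + 1 in Hs.
have B0 : 0 < B by rewrite /B; have := cmod_ge0 (g p); lra.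
pose r1 := Num.min rho s.
have r10 : 0 < r1 by rewrite lt_min rho0.
have r1rho : r1 <= rho by rewrite ge_min lexx.
have r1s : r1 <= s by rewrite ge_min lexx orbT.
clearbody r1.
(* [z1] is at distance [r1 / 4] from [p], while the quotient is estimated at distance at least
   [3 / 8 * r1], near the rim of the disc of radius [r1 / 2]. The ratio of the distances is
   [2 / 3]. *)
pose z1 := p + mkC (r1 / 4) 0.
have z1E : cmod (z1 - p) = r1 / 4 by rewrite /z1 addrAC subrr add0r cmod_real//; lra.
have z1p : z1 != p by rewrite -subr_eq0 -cmod_eq0 z1E gt_eqF//; lra.
have gz1 : 0 < cmod (g z1) by rewrite cmod_gt0; apply: g0 => //; rewrite z1E; lra.
have bound j : cmod (g z1) <= B * (2 / 3) ^+ j.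
  have [q [cq Hq]] := quot j.
  have [|_ ->] := Hq z1 z1p; first by rewrite z1E; lra.
  have r38 : 0 < 3 / 8 * r1 by lra.
  have bj : cmod (q z1) <= B / (3 / 8 * r1) ^+ j.
    apply: (@maximum_principle_punctured R [set z | cmod (z - p) < r1 / 2] q [:: p] _ (r1
      + cmod p)).
    - exact: open_disc.
    - by move=> z /= zr; have := cmodD (z - p) p; rewrite subrK; lra.
    - by rewrite divr_ge0 ?exprn_ge0// ltW.
    - move=> z /= zr; rewrite inE => zp; have [] // := Hq z zp; lra.
    - move=> z; rewrite inE => /eqP ->; have [r r0 Hr] := continuous_bounded cq.
      by exists (cmod (q p) + 1), r; split=> // w _ _; exact: Hr.
    - move=> a /= /negP; rewrite -leNgt => ar e e0; exists (r1 / 8); first by lra.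
      move=> w wr; rewrite inE => wp wa.
      have w38 : 3 / 8 * r1 <= cmod (w - p).
        by have := cmodD (a - w) (w - p); rewrite addrA subrK (cmodB a w); lra.
      apply: le_trans (_ : B / (3 / 8 * r1) ^+ j <= _); last by rewrite lerDl ltW.
      rewrite ler_pdivlMr ?exprn_gt0//.
      have [|_ gE] := Hq w wp; first by lra.
      apply: le_trans (_ : cmod (g w) <= _); last by apply: Hs; lra.
      rewrite gE cmodM cmodX mulrC ler_wpM2r ?cmod_ge0// lerXn2r ?nnegrE ?cmod_ge0//; lra.
    - by rewrite /= z1E; lra.
    - by rewrite inE.
  rewrite cmodM cmodX z1E.
  apply: le_trans (ler_wpM2l (exprn_ge0 j (ltW _)) bj) _; first by lra.
  have -> : (r1 / 4) ^+ j * (B / (3 / 8 * r1) ^+ j) = B * ((r1 / 4) / (3 / 8 * r1)) ^+ j.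
    by rewrite [in RHS]expr_div_n mulrCA.
  by have -> : r1 / 4 / (3 / 8 * r1) = 2 / 3 by field; rewrite gt_eqF.
have [||N HN] := @expr_small R (2 / 3) (cmod (g z1) / (2 * B)).
- by lra.
- by rewrite divr_gt0//; lra.
have := bound N; move: HN; rewrite -(ler_pM2l B0).
have -> : B * (cmod (g z1) / (2 * B)) = cmod (g z1) / 2 by field; rewrite gt_eqF.
lra.
Qed.

(** At most polynomial growth in 1 / |w - p|. Only an upper bound on the order is recorded, so the
    class is closed under sums and products even when leading terms cancel. *)
Definition tame f p := exists k (B r : R), 0 < r /\
  forall w, w != p -> cmod (w - p) < r -> cmod (f w) * cmod (w - p) ^+ k <= B.

Lemma tame_raise f p k (B r : R) : 0 < r ->
  (forall w, w != p -> cmod (w - p) < r -> cmod (f w) * cmod (w - p) ^+ k <= B) ->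
  forall l, (k <= l)%N -> exists2 r' : R, 0 < r' &
  forall w, w != p -> cmod (w - p) < r' -> cmod (f w) * cmod (w - p) ^+ l <= B.
Proof.
move=> r0 Hr l kl; exists (Num.min r 1); first by rewrite lt_min r0 ltr01.
move=> w wp; rewrite lt_min => /andP[wr w1]; apply: le_trans (Hr w wp wr).
by rewrite ler_wpM2l ?cmod_ge0// ler_wiXn2l ?cmod_ge0// ltW.
Qed.

Lemma tame_continuous f p : {for p, continuous f} -> tame f p.
Proof.
move=> /continuous_bounded[r r0 Hr]; exists 0%N, (cmod (f p) + 1), r; split=> // w _.
by rewrite expr0 mulr1; exact: Hr.
Qed.

Lemma tameD f g p : tame f p -> tame g p -> tame (fun w => f w + g w) p.
Proof.
move=> [k [B [r [r0 Hr]]]] [l [D [s [s0 Hs]]]].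
have [r' r'0 Hr'] := tame_raise r0 Hr (leq_addr l k).
have [s' s'0 Hs'] := tame_raise s0 Hs (leq_addl k l).
exists (k + l)%N, (B + D), (Num.min r' s'); split; first by rewrite lt_min r'0.
move=> w wp; rewrite lt_min => /andP[wr ws].
apply: le_trans (_ : (cmod (f w) + cmod (g w)) * cmod (w - p) ^+ (k + l) <= _).
  by rewrite ler_wpM2r ?exprn_ge0 ?cmod_ge0// cmodD.
by rewrite mulrDl lerD ?Hr' ?Hs'.
Qed.

Lemma tameM f g p : tame f p -> tame g p -> tame (fun w => f w * g w) p.
Proof.
move=> [k [B [r [r0 Hr]]]] [l [D [s [s0 Hs]]]].
exists (k + l)%N, (B * D), (Num.min r s); split; first by rewrite lt_min r0.
move=> w wp; rewrite lt_min => /andP[wr ws].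
by rewrite cmodM exprD mulrACA ler_pM ?mulr_ge0 ?exprn_ge0 ?cmod_ge0 ?Hr ?Hs.
Qed.

Lemma tame_cst (c : C R) p : tame (fun=> c) p.
Proof. by apply: tame_continuous; apply: holo_continuous; exact: holo_cst. Qed.

Lemma tame_horner (q : {poly C R}) f p : tame f p -> tame (fun w => q.[f w]) p.
Proof.
move=> tf; elim/poly_ind: q => [|q c IH].
  by under eq_fun do rewrite horner0; exact: tame_cst.
under eq_fun do rewrite hornerMXaddC.
by apply: tameD; [exact: tameM|exact: tame_cst].
Qed.

(** A common exponent lets one power of a single polynomial clear all poles. *)
Lemma tame_uniform f (s : seq (C R)) : (forall p, p \in s -> tame f p) ->
  exists k, forall p, p \in s -> exists B r : R, 0 < r /\
    forall w, w != p -> cmod (w - p) < r -> cmod (f w) * cmod (w - p) ^+ k <= B.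
Proof.
elim: s => [|a s IH] H; first by exists 0%N.
have [k Hk] : exists k, forall p, p \in s -> exists B r : R, 0 < r /\
    forall w, w != p -> cmod (w - p) < r -> cmod (f w) * cmod (w - p) ^+ k <= B.
  by apply: IH => p ps; apply: H; rewrite inE ps orbT.
have [|l [B [r [r0 Hr]]]] := H a; first by rewrite mem_head.
exists (k + l)%N => p; rewrite inE => /predU1P[->|/Hk[D [t [t0 Ht]]]].
  by have [r' r'0 Hr'] := tame_raise r0 Hr (leq_addl k l); exists B, r'.
by have [r' r'0 Hr'] := tame_raise t0 Ht (leq_addr l k); exists D, r'.
Qed.

(** The inverse of [f], set to zero at [p], is continuous there and has an isolated zero; a lower
    bound from [zero_order] is an upper bound for [f]. *)
Lemma pole_tame f p (rho : R) : 0 < rho ->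
  (forall z, z != p -> cmod (z - p) < rho -> holo f z) ->
  (forall M : R, exists2 r : R, 0 < r & forall w, w != p -> cmod (w - p) < r ->
    M < cmod (f w)) ->
  tame f p.
Proof.
move=> rho0 hf fM; have [s s0 Hs] := fM 1.
pose g z := if z == p then 0 else (f z)^-1.
have fn0 z : z != p -> cmod (z - p) < s -> f z != 0.
  by move=> zp zs; rewrite -cmod_gt0; apply: lt_trans (Hs z zp zs); exact: ltr01.
have [|z zp|||k [c [r [c0 r0 Hr]]]] := @zero_order g p (Num.min rho s).
- by rewrite lt_min rho0.
- rewrite lt_min => /andP[zr zs].
  apply: (@holo_near _ (fun w => (f w)^-1)); last by apply: holoV; [exact: fn0|exact: hf].
  apply/nbhs_cmodP; exists (cmod (z - p)); first by rewrite cmod_gt0 subr_eq0.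
  by move=> v vz; rewrite /g; case: eqVneq vz => // ->; rewrite cmodB ltxx.
- by move=> z zp; rewrite lt_min => /andP[_ zs]; rewrite /g (negbTE zp) invr_neq0// fn0.
- apply/continuousC_eps => e e0; have [r r0 Hr] := fM e^-1; exists r => // w wr.
  rewrite {2}/g eqxx subr0 /g; case: eqVneq => [_|wp]; first by rewrite cmod0.
  have := Hr w wp wr => lt.
  by rewrite cmodV invf_plt ?posrE//; apply: lt_trans lt; rewrite invr_gt0.
exists k, c^-1, (Num.min r s); split; first by rewrite lt_min r0.
move=> w wp; rewrite lt_min => /andP[wr ws].
have f0 : 0 < cmod (f w) by rewrite cmod_gt0 fn0.
have := Hr w wp wr; rewrite /g (negbTE wp) cmodV => H.
rewrite -(ler_pM2l c0) divff ?gt_eqF// mulrCA.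
by rewrite -(ler_pM2l f0) in H; rewrite divff ?gt_eqF// in H.
Qed.

(** Induction in Horner form: beyond the threshold the new constant term costs at most half of the
    main term. *)
Lemma poly_growth (q : {poly C R}) : q != 0 -> exists c L : R, 0 < c /\
  forall s, L <= cmod s -> c * cmod s ^+ (size q).-1 <= cmod q.[s].
Proof.
elim/poly_ind: q => [|q a IH]; first by rewrite eqxx.
have [->|q0 _] := eqVneq q 0.
  rewrite mul0r add0r polyC_eq0 => a0; exists (cmod a), 0; split; first by rewrite cmod_gt0.
  by move=> s _; rewrite hornerC size_polyC a0 expr0 mulr1.
have [c [L [c0 HL]]] := IH q0.
exists (c / 2), (Num.max L (Num.max 1 (2 * cmod a / c))); split; first by lra.
move=> s; rewrite !ge_max => /and3P[sL s1 sa].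
rewrite hornerMXaddC size_MXaddC (negbTE q0) /= -(prednK (n := size q)) ?size_poly_gt0//.
have := HL s sL; move: (size q).-1 => k Hk.
have c2 : cmod a <= c / 2 * cmod s ^+ k.+1.
  move: sa; rewrite ler_pdivrMr// => sa.
  have sk : 1 <= cmod s ^+ k by rewrite exprn_ege1.
  have : cmod s <= cmod s ^+ k.+1 by rewrite exprS ler_peMr ?cmod_ge0.
  by move=> ssk; nra.
have : cmod (q.[s] * s) <= cmod (q.[s] * s + a) + cmod a.
  by have := cmodD (q.[s] * s + a) (- a); rewrite addrK cmodN.
rewrite cmodM => H.
have : c * cmod s ^+ k.+1 <= cmod q.[s] * cmod s by rewrite exprSr mulrA ler_wpM2r ?cmod_ge0.
by lra.
Qed.

End ZeroOrder.

(** * Lemniscates *)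

Section Lemniscate.
Variable R : realType.
Implicit Types (z w p : C R).

Lemma cmod_conj z : cmod z^* = cmod z.
Proof.
by apply/eqP; rewrite -(@eqrXn2 _ 2) ?cmod_ge0// !cmod_sqr cre_conj cim_conj sqrrN.
Qed.

Lemma mul_conj_cmod z : cmod z = 1 -> z * z^* = 1.
Proof.
move=> z1; have z2 : cre z ^+ 2 + cim z ^+ 2 = 1 by rewrite -cmod_sqr z1 expr1n.
rewrite -[LHS]mkC_re_im -[RHS]mkC_re_im; congr mkC.
  by rewrite creM cre_conj cim_conj cre1 -z2; ring.
by rewrite cimM cre_conj cim_conj cim1; ring.
Qed.

Variables (P : {poly C R}) (S : C R -> C R) (Z : seq (C R)) (b : R).
Let Omega : set (C R) := [set z | cmod P.[z] < 1].
Hypothesis monP : P \is monic.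
Hypothesis szP : (1 < size P)%N.
Hypothesis bOmega : forall z, Omega z -> cmod z <= b.
Hypothesis holoS : forall z, Omega z -> z \notin Z -> holo S z.
Hypothesis subZ : forall z, z \in Z -> Omega z.
Hypothesis poleS : forall p, p \in Z -> forall M : R,
  exists2 r : R, 0 < r & forall w, w != p -> cmod (w - p) < r -> M < cmod (S w).
Hypothesis boundaryS : forall a, ~ Omega a ->
  (forall r : R, 0 < r -> exists2 w, Omega w & cmod (w - a) < r) ->
  forall e : R, 0 < e -> exists2 r : R, 0 < r & forall w, Omega w -> w \notin Z ->
    cmod (w - a) < r -> cmod (S w - a^*) < e.

Let Pc : {poly C R} := map_poly Num.conj P.

Let PcE z : Pc.[z^*] = P.[z]^*.
Proof. by rewrite /Pc horner_map. Qed.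

Let horner_eps (q : {poly C R}) z (e : R) : 0 < e ->
  exists2 r : R, 0 < r & forall w, cmod (w - z) < r -> cmod (q.[w] - q.[z]) < e.
Proof.
have /holo_continuous/continuousC_eps : holo (fun w => q.[w]) z.
  by apply: holo_horner; exact: holo_id.
exact.
Qed.

Let openOmega : open Omega.
Proof.
apply/open_cmodP => z Oz; have [|r r0 Hr] := @horner_eps P z (1 - cmod P.[z]).
  by rewrite subr_gt0.
exists r => // w /Hr; have := cmodD (P.[w] - P.[z]) P.[z]; rewrite subrK /Omega /=; lra.
Qed.

Let isolated p : p \in Z -> exists2 r : R, 0 < r & forall z, z != p -> cmod (z - p) < r ->
  Omega z /\ z \notin Z.
Proof.
move=> pZ; have [s s0 Hs] := (open_cmodP Omega).1 openOmega p (subZ pZ).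
suff [r r0 Hr] : exists2 r : R, 0 < r & forall z, z != p -> cmod (z - p) < r -> z \notin Z.
  exists (Num.min r s); first by rewrite lt_min r0.
  by move=> z zp; rewrite lt_min => /andP[zr zs]; split; [exact: Hs|exact: Hr].
elim: (Z) => [|a l [r r0 Hr]]; first by exists 1.
have [ap|ap] := eqVneq a p.
  by exists r => // z zp zr; rewrite inE negb_or ap zp Hr.
exists (Num.min r (cmod (a - p))); first by rewrite lt_min r0 cmod_gt0 subr_eq0.
move=> z zp; rewrite lt_min => /andP[zr za]; rewrite inE negb_or Hr// andbT.
by apply/eqP => E; move: za; rewrite E ltxx.
Qed.

Lemma schwarz_identity z : Omega z -> z \notin Z -> P.[z] * Pc.[S z] = 1.
Proof.
move=> Oz zZ; apply/eqP; rewrite -subr_eq0; move: z Oz zZ.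
pose F w := P.[w] * Pc.[S w] - 1.
have tF p : p \in Z -> tame F p.
  move=> pZ; have [r r0 Hr] := isolated pZ.
  have tS : tame S p.
    apply: (pole_tame r0); last exact: poleS.
    by move=> z zp zr; have [Oz zZ] := Hr z zp zr; exact: holoS.
  apply: tameD; last exact: tame_cst.
  apply: tameM; apply: tame_horner => //.
  by apply: tame_continuous; apply: holo_continuous; exact: holo_id.
have [K HK] := tame_uniform tF.
pose om : {poly C R} := \prod_(a <- Z) ('X - a%:P).
have om0 w : (om.[w] == 0) = (w \in Z) by rewrite -root_prod_XsubC.
have [D D0 HD] := poly_bounded om b.
suff G0 z : Omega z -> z \notin Z -> cmod (F z * om.[z] ^+ K) <= 0.
  move=> z Oz zZ; have := G0 z Oz zZ; rewrite le_eqVlt ltNge cmod_ge0 orbF cmod_eq0.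
  by rewrite mulf_eq0 expf_eq0 om0 (negbTE zZ) andbF orbF.
apply: (@maximum_principle_punctured R Omega (fun w => F w * om.[w] ^+ K) Z 0 b) => //.
- move=> w Ow wZ; apply: holoM.
    apply: holoB; last exact: holo_cst.
    by apply: holoM; apply: holo_horner; [exact: holo_id|exact: holoS].
  by apply: holoX; apply: holo_horner; exact: holo_id.
- move=> p pZ; have [B [r [r0 Hr]]] := HK p pZ.
  (* One factor [w - p] of [om] is split off; its [K]-th power compensates the growth of [F], and
     the cofactor is bounded on [Omega]. *)
  have /factor_theorem[q omE] : root om p by rewrite /root om0.
  have [D' D'0 HD'] := poly_bounded q b.
  exists (B * D' ^+ K), r; split=> // w Ow wZ wr.
  have wp : w != p by apply: contraNneq wZ => ->.
  rewrite omE hornerM hornerXsubC exprMn mulrCA mulrC !cmodM !cmodX.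
  rewrite ler_pM ?mulr_ge0 ?exprn_ge0 ?cmod_ge0 ?Hr//.
  by rewrite lerXn2r ?nnegrE ?cmod_ge0// HD'// bOmega.
move=> a nOa e e0; rewrite add0r.
case: (pselect (forall r : R, 0 < r -> exists2 w, Omega w & cmod (w - a) < r)) => [cla|];
  last first.
  move=> /existsNP[r /not_implyP[r0 no]]; exists r => // w Ow _ wa.
  by exfalso; apply: no; exists w.
(* [a] is outside [Omega] but adherent to it, which gives the two inequalities. *)
have Pa1 : cmod P.[a] = 1.
  apply/eqP; rewrite eq_le; apply/andP; split; last by rewrite leNgt; apply/negP.
  apply/ler_addgt0Pr => e' e'0; have [r r0 Hr] := @horner_eps P a e' e'0.
  have [w Ow wa] := cla r r0; have := Hr w wa.
  by have := cmodD (P.[a] - P.[w]) P.[w]; rewrite subrK (cmodB P.[a]); move: Ow;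
    rewrite /Omega /=; lra.
have D1 : 0 < D ^+ K + 1 by rewrite ltr_wpDl// exprn_ge0.
pose e2 := e / (D ^+ K + 1) / 2.
have e20 : 0 < e2 by rewrite !divr_gt0.
have [r r0 Hr] := @horner_eps P a e2 e20.
have [s s0 Hs] := @horner_eps Pc a^* e2 e20.
have [t t0 Ht] := boundaryS nOa cla s0.
exists (Num.min r t); first by rewrite lt_min r0.
move=> w Ow wZ; rewrite lt_min => /andP[wr wt].
have Fw : cmod (F w) <= e / (D ^+ K + 1).
  have -> : F w = P.[w] * (Pc.[S w] - Pc.[a^*]) + (P.[w] - P.[a]) * Pc.[a^*].
    by rewrite /F -(mul_conj_cmod Pa1) PcE; ring.
  apply: le_trans (cmodD _ _) _; rewrite !cmodM PcE cmod_conj Pa1 mulr1.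
  have H1 := Hr w wr; have := Hs _ (Ht w Ow wZ wt); rewrite PcE => H2.
  have : cmod P.[w] * cmod (Pc.[S w] - P.[a]^*) <= 1 * cmod (Pc.[S w] - P.[a]^*).
    by rewrite ler_wpM2r ?cmod_ge0// ltW.
  by move: H1 H2; rewrite /e2; lra.
rewrite cmodM cmodX; apply: le_trans (_ : e / (D ^+ K + 1) * D ^+ K <= _).
  rewrite ler_pM ?exprn_ge0 ?cmod_ge0// lerXn2r ?nnegrE ?cmod_ge0// HD//; exact: bOmega.
by rewrite mulrAC ler_pdivrMr// ler_wpM2l ?(ltW e0)// lerDl.
Qed.

(* If the multiplicity [m] of the root [p] were smaller than [n = deg P], then
   [|S|^n ~ |z - p|^-m] would force [(z - p) S z --> 0], so [S] would be bounded at [p]. *)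
Lemma lemniscate_one_root : exists p, P = ('X - p%:P) ^+ (size P).-1.
Proof.
have [|p rp] := closed_rootP P _; first by rewrite gtn_eqF.
have Op : Omega p by rewrite /Omega /= (rootP rp) cmod0 ltr01.
(* Elsewhere in [Omega] the identity would read 0 = 1 at the root [p]. *)
have pZ : p \in Z.
  apply: contraT => /(schwarz_identity Op); rewrite (rootP rp) mul0r => /eqP.
  by rewrite eq_sym oner_eq0.
have P0 : P != 0 by exact: monic_neq0.
have [m [Q]] := multiplicity_XsubC P p; rewrite P0 /= => Qp PE.
have monQ : Q \is monic by move: monP; rewrite PE monicMr// monic_exp// monicXsubC.
exists p; set n := (size P).-1.
have nE : n = ((size Q).-1 + m)%N.
  rewrite /n PE size_Mmonic ?monic_exp ?monicXsubC//; last by exact: monic_neq0.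
  rewrite size_exp_XsubC addnS /=.
  by rewrite -[in LHS](prednK (n := size Q)) ?size_poly_gt0 ?monic_neq0// addSn.
case: (posnP (size Q).-1) => [Q1|Qn0].
  have /size_poly1P[c c0 Qc] : size Q == 1%N.
    by rewrite -(prednK (n := size Q)) ?size_poly_gt0 ?monic_neq0// Q1.
  have c1 : c = 1 by move: monQ; rewrite Qc monicE lead_coefC => /eqP.
  by rewrite {1}PE nE Q1 add0n Qc c1 mul1r.
exfalso.
have Pc0 : Pc != 0 by rewrite map_poly_eq0.
have szPc : (size Pc).-1 = n by rewrite size_map_poly.
have [c [L [c0 HL]]] := poly_growth Pc0; rewrite szPc in HL.
have [r r0 Hr] := isolated pZ.
have [s s0 Hs] := poleS pZ L.
have kap0 : 0 < cmod Q.[p] / 2 by rewrite divr_gt0// cmod_gt0.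
have [t t0 Ht] := @horner_eps Q p _ kap0.
set kap := cmod Q.[p] / 2 in kap0 Ht.
pose rho := Num.min (Num.min r s) (Num.min t 1).
have rho0 : 0 < rho by rewrite !lt_min r0 s0 t0 ltr01.
pose f z := (z - p) * S z.
(* In |z - p|^m |Q z| |Pc (S z)| = 1 the last two factors are at least [kap] and c |S z|^n, and |z -
   p|^n <= |z - p|^(m + 1), since m < n and |z - p| < 1. *)
have fb z : z != p -> cmod (z - p) < rho -> cmod (f z) ^+ n <= cmod (z - p) / (c * kap).
  move=> zp; rewrite !lt_min => /andP[/andP[zr zs] /andP[zt z1]].
  have [Oz zZ] := Hr z zp zr; have := schwarz_identity Oz zZ.
  move=> /(congr1 (@cmod R)); rewrite cmod1 PE hornerM horner_exp hornerXsubC !cmodM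
    cmodX => E.
  have SL := HL _ (ltW (Hs z zp zs)).
  have Qk : kap <= cmod Q.[z].
    have := Ht z zt; have := cmodD (Q.[p] - Q.[z]) Q.[z]; rewrite subrK (cmodB Q.[p]).
    by rewrite /kap; lra.
  have x0 := cmod_ge0 (z - p).
  have ck0 : 0 < c * kap by exact: mulr_gt0.
  rewrite (ler_pdivlMr _ _ ck0) exprMn.
  have xn : cmod (z - p) ^+ n <= cmod (z - p) * cmod (z - p) ^+ m.
    by rewrite -exprS ler_wiXn2l// ?ltW// nE -add1n leq_add2r.
  apply: le_trans (_ : cmod (z - p) * cmod (z - p) ^+ m * cmod (S z) ^+ n * (c * kap) <= _).
    by rewrite ler_wpM2r ?(ltW (mulr_gt0 c0 kap0))// ler_wpM2r ?exprn_ge0 ?cmod_ge0.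
  rewrite -[leRHS]mulr1 -E.
  have -> : cmod (z - p) * cmod (z - p) ^+ m * cmod (S z) ^+ n * (c * kap) =
    cmod (z - p) * (kap * cmod (z - p) ^+ m * (c * cmod (S z) ^+ n)) by ring.
  rewrite ler_wpM2l// ler_pM ?mulr_ge0 ?exprn_ge0 ?cmod_ge0 ?(ltW kap0) ?(ltW c0)//.
  by rewrite ler_wpM2r ?exprn_ge0 ?cmod_ge0.
have n0 : (0 < n)%N by rewrite nE addn_gt0 Qn0.
have fp : f p = 0 by rewrite /f subrr mul0r.
have cf : {for p, continuous f}.
  apply/continuousC_eps => e e0.
  have ck0 : 0 < c * kap by exact: mulr_gt0.
  have d0 : 0 < e ^+ n * (c * kap) by apply: mulr_gt0 => //; exact: exprn_gt0.
  exists (Num.min rho (e ^+ n * (c * kap))); first by rewrite lt_min rho0.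
  move=> z; rewrite lt_min fp subr0 => /andP[zrho ze].
  have [->|zp] := eqVneq z p; first by rewrite fp cmod0.
  rewrite -(@ltr_pXn2r _ n) ?nnegrE ?cmod_ge0 ?(ltW e0)//.
  by apply: le_lt_trans (fb z zp zrho) _; rewrite (ltr_pdivrMr _ _ ck0).
have [|d cd] := @removable_singularity R f p r r0 _ cf.
  move=> z zp zr; have [Oz zZ] := Hr z zp zr.
  by apply: holoM; [exact: holo_subid|exact: holoS].
have [u u0 Hu] := continuous_bounded cd.
(* Away from [p] the slope of [f] is [S] itself, as [f p = 0]; continuity of the slope bounds it
   near [p], against the pole. *)
have [v v0 Hv] := poleS pZ (cmod (slope f p d p) + 1).
pose x := Num.min u v / 2.
have m0 : 0 < Num.min u v by rewrite lt_min u0.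
have x0 : 0 < x by rewrite divr_gt0.
have : x < Num.min u v by rewrite /x; lra.
rewrite lt_min => /andP[xu xv].
pose w := p + mkC x 0.
have wE : cmod (w - p) = x by rewrite /w addrAC subrr add0r cmod_real// ltW.
have wp : w != p by rewrite -subr_eq0 -cmod_eq0 wE gt_eqF.
have := Hu w; have := Hv w wp; rewrite wE => /(_ xv) H /(_ xu).
rewrite {1}/slope (negbTE wp) fp subr0 /f mulrC mulKf ?subr_eq0//.
by rewrite leNgt H.
Qed.
End Lemniscate.

Theorem theorem4p2 (R : realType) (P : {poly C R}) :
  P \is monic -> (1 < size P)%N ->
  let Omega := [set z : C R | `|P.[z]| < 1] in
  quadrature_domain Omega ->
  exists (a : C R) (r : R), 0 < r /\ Omega = [set z : C R | `|z - a| < (r%:C)%C].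
Proof.
move=> monP szP Omega [Gamma [[oO _ _ bO [_ GE]] [S [Z [[finZ subZ] holoS poleS contS SG]]]]].
have cm (z : C R) (M : R) : (`|z| < (M%:C)%C) = (cmod z < M).
  by rewrite normC_cmod ltcR.
have OE : Omega = [set z | cmod P.[z] < 1] by apply/funext => z; rewrite /Omega /= -cm.
have [b Hb] : exists b : R, forall z, Omega z -> cmod z <= b.
  move: bO => [M [Mr HM]]; exists (complex.Re (M + 1)) => z Oz.
  have := HM (M + 1); rewrite ltrDl ltr01 => /(_ isT z Oz) /=.
  by rewrite normC_cmod lecE => /andP[_].
have [s Zs] := (finite_seqP Z).1 finZ.
have ZP z : reflect (Z z) (z \in s) by rewrite Zs; exact: idP.
have [] := @lemniscate_one_root R P S s b monP szP.
- by rewrite -OE.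
- by rewrite -OE => z Oz /ZP nZz; rewrite holo.unlock; exact: holoS.
- by rewrite -OE => z /ZP; exact: subZ.
- move=> p /ZP Zp M; have /nbhs_cmodP[r r0 Hr] := poleS p Zp M.
  exists r => // w wp wr; have := Hr w wr wp.
  by rewrite /= normC_cmod ltcR.
- rewrite -OE => a nOa cla e e0.
  have Ga : Gamma a.
    rewrite -GE; split => // A /nbhs_cmodP[r r0 Hr].
    by have [w Ow wa] := cla r r0; exists w; split => //; exact: Hr.
  (* Poles lie inside [Omega], so a boundary point is never one of them and [S] is continuous
     there. *)
  have Da : (closure Omega `\` Z) a.
    by split; [move: Ga; rewrite -GE => -[]|move=> /subZ].
  have nSa : nbhs (S a) [set x : C R | cmod (x - a^*) < e].
    by apply/nbhs_cmodP; exists e => // w; rewrite SG.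
  have : nbhs_subspace (a : subspace (closure Omega `\` Z)) [set x : C R | cmod (S x -
    a^*) < e].
    exact: (contS a _ nSa).
  rewrite -(nbhs_subspace_in Da) => /nbhs_cmodP[r r0 Hr].
  exists r => // w Ow /ZP nZw wa; apply: Hr => //; split => //; exact: subset_closure.
(* Since the degree is positive, |z - a|^n < 1 means |z - a| < 1, whence the radius [1]. *)
move=> a PE; exists a, 1; split => //; rewrite OE; apply/funext => z /=.
rewrite cm PE horner_exp hornerXsubC cmodX expr_lt1 ?cmod_ge0//.
by rewrite -subn1 subn_gt0.
Qed.
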